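(* Let $t$ be a rational integer congruent to $-16$, $-11$, $-5$, $0$, $6$ or $11$ modulo $49$, or to $743$ modulo $2401$. If the polynomial $$Y^3-tY^2-(2t^2-7t+21)Y+t^3+28$$ is irreducible over $\mathbb{Q}$, then for $y$ a root of it, $\mathbb{Q}(y)$ is a cyclic extension of $\mathbb{Q}$; and if $$p(x)=x^7-14x^4-7(t-3)x^3+14tx^2-28x+t^2-11t+33$$ is likewise irreducible over $\mathbb{Q}$, then the splitting field of $p(x)$ over $K=\mathbb{Q}(\sqrt{-7},\,y)$ is an unramified cyclic extension of $K$.
   Context: A cyclic extension is a Galois extension with cyclic Galois group. *)

(* Defs.v *)
From HB Require Import structures.
From mathcomp Require Import all_boot all_order all_algebra.
From mathcomp Require Import all_fingroup all_solvable all_field.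

Set Implicit Arguments.
Unset Strict Implicit.
Unset Printing Implicit Defensive.

Import Order.TTheory GRing.Theory Num.Theory.
Local Open Scope ring_scope.

Definition cyclic_extension (F : fieldType) (L : splittingFieldType F)
    (K E : {subfield L}) : bool :=
  galois K E && cyclic 'Gal(E / K)%g.

(* Ideals are Prop-valued predicates on the ambient number field L, contained
   in the ring of integers A of some subfield of L; A is itself such a
   predicate. *)
Section Ideals.
Variable L : fieldExtType rat.
Implicit Types (A I J P : L -> Prop) (K E : {subfield L}).

Definition ring_of_integers E : L -> Prop :=
  fun x => x \in E /\ integralOver (intr : int -> L) x.

Definition pred_sub I J : Prop := forall x, I x -> J x.

Definition is_ideal A I : Prop :=
  [/\ pred_sub I A, I 0,
      forall x y, I x -> I y -> I (x + y)
    & forall a x, A a -> I x -> I (a * x)].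

Definition is_prime_ideal A P : Prop :=
  [/\ is_ideal A P, ~ P 1
    & forall a b, A a -> A b -> P (a * b) -> P a \/ P b].

Definition ideal_mul I J : L -> Prop :=
  fun x => exists2 s : seq (L * L),
    forall u, u \in s -> I u.1 /\ J u.2 & x = \sum_(u <- s) u.1 * u.2.

Fixpoint ideal_exp A I (n : nat) : L -> Prop :=
  if n is m.+1 then ideal_mul I (ideal_exp A I m) else A.

(* With p the prime of O_K below P, e is the largest exponent such that
   p O_E is contained in P ^ e, i.e. the exponent of P in the factorization
   of p O_E. *)
Definition is_ramification_index K E P (e : nat) : Prop :=
  let A := ring_of_integers E in
  let p := fun x => P x /\ x \in K in
  pred_sub (ideal_mul p A) (ideal_exp A P e)
  /\ ~ pred_sub (ideal_mul p A) (ideal_exp A P e.+1).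

(* Residue fields of number fields are finite, hence perfect, so that no
   separability condition on the residue extension is needed. *)
Definition unramified_finite K E : Prop :=
  forall P, is_prime_ideal (ring_of_integers E) P ->
    (exists2 x, P x & x != 0) -> is_ramification_index K E P 1.

(* An infinite place ramifies when it is complex and lies above a real one.
   The embeddings of E in the complex numbers are the restrictions to E of the
   embeddings of L, and these take their values in algC. *)
Definition unramified_infinite K E : Prop :=
  forall sigma : {rmorphism L -> algC},
    (forall x, x \in K -> sigma x \is Num.real) ->
    forall x, x \in E -> sigma x \is Num.real.

Definition unramified_extension K E : Prop :=
  [/\ (K <= E)%VS, unramified_finite K E & unramified_infinite K E].

End Ideals.

Definition cubic (t : int) : {poly rat} :=
  'X^3 - t%:~R *: 'X^2 - (2 * t ^+ 2 - 7 * t + 21)%:~R *: 'X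
  + (t ^+ 3 + 28)%:~R%:P.

Definition septic (t : int) : {poly rat} :=
  'X^7 - 14 *: 'X^4 - (7 * (t - 3))%:~R *: 'X^3 + (14 * t)%:~R *: 'X^2
  - 28 *: 'X + (t ^+ 2 - 11 * t + 33)%:~R%:P.

Definition admissible (t : int) : Prop :=
  [\/ [\/ (t = - 16 %[mod 49])%Z, (t = - 11 %[mod 49])%Z
        | (t = - 5 %[mod 49])%Z],
      [\/ (t = 0 %[mod 49])%Z, (t = 6 %[mod 49])%Z
        | (t = 11 %[mod 49])%Z]
    | (t = 743 %[mod 2401])%Z].

(* Main.v *)
(** Over an algebraically closed field let m1, m2, m4 be the roots of Shanks'
    cubic M^3 - (t - 3) M^2 - t M - 1, ordered so that M |-> - 1 / (1 + M) permutes
    them cyclically, and put r1 = (m1^3 m2)^(1/7), r2 = r1^2 / m1, r4 = r2^2 / m2,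
    a point of Klein's quartic. The roots of the septic are the
    w r1 + w^2 r2 + w^4 r4 with w^7 = 1. If a is a primitive seventh root of unity
    and n_i = a^i + a^-i, then the roots of the cubic are 1 - (n1 m1 + n2 m2 + n4 m4)
    and its images under the cyclic shift of the m_i. An automorphism fixing
    sqrt -7 and y shifts a, a^2, a^4 and m1, m2, m4 by the same amount, hence acts on
    the roots of the septic as w |-> c w with c^7 = 1.

    Let P be a prime of E above l, and suppose that some g <> 1 is in the inertia
    group of P. The seven roots of the septic form one orbit of g, so they are
    congruent modulo P. If l <> 7, they are in P because their sum is 0, and then
    the coefficients of the septic generate the unit ideal, a contradiction. If
    l = 7, the congruence on t provides an integral element of E whose trace is
    prime to 7, but inertia makes this trace 7 times an algebraic integer modulo P.

    That trivial inertia implies ramification index 1 is shown without Dedekind's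
    theory: there are algebraic integers x_i, y_i in E such that sum_i x_i g(y_i) is 0 for
    g <> 1 and is some D outside P for g = 1. Then z D = sum_i x_i Tr(y_i z) is in
    p O_E if all the conjugates of z are in P, so that p O_E <= P^2 would imply
    P = P^2, contrary to Nakayama's lemma. *)

Require Import Defs.
From HB Require Import structures.
From mathcomp Require Import all_boot all_order all_algebra.
From mathcomp Require Import all_fingroup all_solvable all_field.
From mathcomp Require Import ring.
From Stdlib Require Import Classical_Prop.

Set Implicit Arguments.
Unset Strict Implicit.
Unset Printing Implicit Defensive.

Import Order.TTheory GRing.Theory Num.Theory.
Local Open Scope ring_scope.

(** * Complex embeddings of number fields *)

(** A primitive element z is sent to a complex root c of its minimal polynomial, and p(z) to p(c).
    The choice of p is immaterial because the minimal polynomial divides every p with p(z) = 0. *)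
Lemma num_field_embedding (L : fieldExtType rat) :
  exists iota : L -> algC, GRing.zmod_morphism iota /\ GRing.monoid_morphism iota.
Proof.
have sepL : separable 1%AS {:L}%AS.
  apply/separableP => x _; apply: pcharf0_separable.
  by move=> p; rewrite (pchar_lalg L) pchar_num.
have [z Ez] : exists z : L, {:L}%VS = <<1; z>>%VS.
  by exists (separable_generator 1 {:L}); apply: eq_adjoin_separable_generator; rewrite ?sub1v.
have Lz x : {p : {poly rat} | x == (map_poly (in_alg L) p).[z]}.
  by apply: sigW; have /Fadjoin1_polyP[p ->]: x \in <<1; z>>%VS; [rewrite -Ez memvf | exists p].
have [q Dq] : exists q : {poly rat}, minPoly 1 z = map_poly (in_alg L) q.
  by have /polyOver1P[q ->] := minPolyOver 1%AS z; exists q.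
have sq : size (map_poly (ratr : rat -> algC) q) != 1.
  by rewrite size_map_poly -(size_map_poly (in_alg L)) -Dq size_minPoly eqSS adjoin_degreeE
      -lt0n -Ez ltn_divRL ?dvd1n ?adim_gt0 // ; rewrite dimv1 //= mul0n adim_gt0.
have [c rc] := closed_rootP _ sq.
have wd p : (map_poly (in_alg L) p).[z] = 0 -> (map_poly (ratr : rat -> algC) p).[c] = 0.
  move=> p0; have: minPoly 1 z %| map_poly (in_alg L) p.
    by apply: minPoly_dvdp; [apply: alg_polyOver | apply/rootP].
  rewrite Dq dvdp_map => /dvdpP[r ->].
  by rewrite rmorphM hornerM (rootP rc) mulr0.
pose f x := (map_poly (ratr : rat -> algC) (sval (Lz x))).[c].
have fE x p : x = (map_poly (in_alg L) p).[z] -> f x = (map_poly (ratr : rat -> algC) p).[c].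
  move=> Dx; apply/eqP; rewrite -subr_eq0 -hornerN -hornerD -rmorphN -rmorphD wd //.
  by rewrite rmorphB hornerD hornerN -(eqP (svalP (Lz x))) Dx subrr.
have Df x := eqP (svalP (Lz x)).
exists f; split=> [x y|].
  rewrite (fE _ (sval (Lz x) - sval (Lz y))) ?rmorphB ?hornerD ?hornerN //.
  by rewrite -!Df.
split=> [|x y]; first by rewrite (fE _ 1) ?rmorph1 ?hornerC.
rewrite (fE _ (sval (Lz x) * sval (Lz y))) ?rmorphM ?hornerM //.
by rewrite -!Df.
Qed.

(** * Identities for Klein's quartic, Shanks' cubic and the two polynomials *)

Section KleinIdentities.
Variable F : fieldType.
Implicit Types a z r : F.
Definition klein_sum r1 r2 r4 a : F := a * r1 + a ^+ 2 * r2 + a ^+ 4 * r4.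
(* The product of the factors z - klein_sum b for the conjugates b = a, a^2,
   a^4 of a seventh root of unity a, with e = a + a^2 + a^4 = (-1 +- sqrt -7) / 2. *)
Definition klein_cubic r1 r2 r4 e z : F :=
  z ^+ 3 - e * (r1 + r2 + r4) * z ^+ 2
  - ((1 + e) * (r1 ^+ 2 + r2 ^+ 2 + r4 ^+ 2) + (r1 * r2 + r2 * r4 + r4 * r1)) * z
  - (r1 ^+ 3 + r2 ^+ 3 + r4 ^+ 3
     + e * (r1 ^+ 2 * r2 + r2 ^+ 2 * r4 + r4 ^+ 2 * r1)
     - (1 + e) * (r1 ^+ 2 * r4 + r2 ^+ 2 * r1 + r4 ^+ 2 * r2)
     + (2 - e) * (r1 * r2 * r4)).
Lemma klein_cubicE a z r1 r2 r4 : a^+6 = - (a ^+ 5 + a ^+ 4 + a ^+ 3 + a ^+ 2 + a + 1) ->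
  (z - klein_sum r1 r2 r4 a) * (z - klein_sum r1 r2 r4 (a ^+ 2)) * (z - klein_sum r1 r2 r4 (a ^+ 4))
  = klein_cubic r1 r2 r4 (a + a ^+ 2 + a ^+ 4) z.
Proof.
move=> a6.
rewrite /klein_sum /klein_cubic.
ring: a6.
Qed.

(** The roots are the values of [klein_sum] at the seventh roots of unity: 1 gives the linear
    factor, and e and - 1 - e, the two values of (-1 +- sqrt -7) / 2, give the two cubics. *)
Lemma klein_septicE e z r1 r2 r4 : e ^+ 2 = - e - 2 ->
  (z - (r1 + r2 + r4)) * klein_cubic r1 r2 r4 e z * klein_cubic r1 r2 r4 (- 1 - e) z
  = z ^+ 7 - 14 * (r1 * r2 * r4) * z ^+ 4
    - 7 * (r1 ^+ 3 * r4 + r2 ^+ 3 * r1 + r4 ^+ 3 * r2) * z ^+ 3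
    - 14 * (r1 ^+ 3 * r2 ^+ 2 + r2 ^+ 3 * r4 ^+ 2 + r4 ^+ 3 * r1 ^+ 2) * z ^+ 2
    - 7 * (r1 ^+ 5 * r2 + r2 ^+ 5 * r4 + r4 ^+ 5 * r1 + (r1 * r2 * r4) ^+ 2) * z
    - (r1 ^+ 7 + r2 ^+ 7 + r4 ^+ 7)
    - 7 * (r1 * r2 * r4) * (r1 ^+ 3 * r4 + r2 ^+ 3 * r1 + r4 ^+ 3 * r2).
Proof.
move=> e2; rewrite /klein_cubic.
ring: e2.
Qed.

(* The hypotheses below say that m1, m2, m4 are cyclically permuted by
   M |-> -1 / (1 + M), i.e. are the roots of Shanks' simplest cubic of
   parameter t - 3. *)
Section Param.
Variables (m1 m2 m4 t : F).
Hypotheses (m12 : m1 * m2 = - 1 - m2) (m24 : m2 * m4 = - 1 - m4) (m41 : m4 * m1 = - 1 - m1).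
Hypothesis (Dt : t = m1 + m2 + m4 + 3).

Lemma shanks_prod : m1 * m2 * m4 = 1.
Proof. by rewrite m12 mulrBl mulN1r m24; ring. Qed.

Let m1_neq0 : m1 != 0.
Proof.
by apply/eqP=> m0; have/eqP := shanks_prod; rewrite m0 !mul0r eq_sym oner_eq0.
Qed.
Let m11_neq0 : 1 + m1 != 0.
Proof.
apply/eqP=> m11; have: m2 * (1 + m1) = -1 by ring: m12.
by rewrite m11 mulr0 => /eqP; rewrite eq_sym oppr_eq0 oner_eq0.
Qed.
Let Dm2 : m2 = - (1 + m1)^-1.
Proof. by apply: (mulIf m11_neq0); rewrite mulNr mulVf //; ring: m12. Qed.
Let Dm4 : m4 = - (1 + m1) / m1.
Proof. by apply: (mulIf m1_neq0); rewrite mulfVK // m41; ring. Qed.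

Lemma shanks_factor x : x ^+ 3 - (t - 3) * x ^+ 2 - t * x - 1 = (x - m1) * (x - m2) * (x - m4).
Proof. by rewrite Dt Dm2 Dm4; field; apply/andP. Qed.

(** For [a ^+ 7 = 1] this is a + 1 / a, kept polynomial in a. *)
Definition cosine2 a : F := a + a ^+ 6.
Definition cubic_value n1 n2 n4 a : F := 1 - (cosine2 a * n1 + cosine2 (a ^+ 2) * n2 + cosine2
    (a ^+ 4) * n4).

Lemma cubic_factor a x : a^+6 = - (a ^+ 5 + a ^+ 4 + a ^+ 3 + a ^+ 2 + a + 1) ->
  x ^+ 3 - t * x ^+ 2 - (2 * t ^+ 2 - 7 * t + 21) * x + (t ^+ 3 + 28)
  = (x - cubic_value m1 m2 m4 a) * (x - cubic_value m2 m4 m1 a) * (x - cubic_value m4 m1 m2 a).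
Proof.
move=> a6; rewrite Dt /cubic_value /cosine2.
have a7 : a ^+ 7 = 1 by ring: a6.
rewrite Dm2 Dm4.
field: a7 a6; last by apply/andP.
Qed.

(** Multiplied by a suitable power of r1 r2 r4 = 1, each term of the coefficients in [klein_septicE]
    becomes a monomial in m1, m2, m4, which the Shanks relations then express through t. *)
Lemma klein_septic_factor r1 r2 r4 e z : r1 * r2 * r4 = 1 ->
    r1 ^+ 3 * r4 = m1 -> r2 ^+ 3 * r1 = m2 -> r4 ^+ 3 * r2 = m4 -> e ^+ 2 = - e - 2 ->
  (z - (r1 + r2 + r4)) * klein_cubic r1 r2 r4 e z * klein_cubic r1 r2 r4 (- 1 - e) z
  = z ^+ 7 - 14 * z ^+ 4 - 7 * (t - 3) * z ^+ 3 + 14 * t * z ^+ 2 - 28 * z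
     + (t ^+ 2 - 11 * t + 33).
Proof.
move=> R M1 M2 M4 e2; rewrite klein_septicE // R M1 M2 M4.
have -> : r1 ^+ 3 * r2 ^+ 2 = m1 * m2 by rewrite -[LHS]mulr1 -R -M1 -M2; ring.
have -> : r2 ^+ 3 * r4 ^+ 2 = m2 * m4 by rewrite -[LHS]mulr1 -R -M2 -M4; ring.
have -> : r4 ^+ 3 * r1 ^+ 2 = m4 * m1 by rewrite -[LHS]mulr1 -R -M4 -M1; ring.
have -> : r1 ^+ 5 * r2 = m1 * (m1 * m2) by rewrite -[LHS]mulr1 -[1](expr1n _ 2) -R -M1 -M2; ring.
have -> : r2 ^+ 5 * r4 = m2 * (m2 * m4) by rewrite -[LHS]mulr1 -[1](expr1n _ 2) -R -M2 -M4; ring.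
have -> : r4 ^+ 5 * r1 = m4 * (m4 * m1) by rewrite -[LHS]mulr1 -[1](expr1n _ 2) -R -M4 -M1; ring.
have -> : r1 ^+ 7 = m1 ^+ 2 * (m1 * m2) by rewrite -[LHS]mulr1 -[1](expr1n _ 3) -R -M1 -M2; ring.
have -> : r2 ^+ 7 = m2 ^+ 2 * (m2 * m4) by rewrite -[LHS]mulr1 -[1](expr1n _ 3) -R -M2 -M4; ring.
have -> : r4 ^+ 7 = m4 ^+ 2 * (m4 * m1) by rewrite -[LHS]mulr1 -[1](expr1n _ 3) -R -M4 -M1; ring.
rewrite m12 m24 m41 Dt; ring: m12 m24 m41.
Qed.

(* The chosen r1, r2, r4 with r1^7 = m1^3 m2 give a point of Klein's quartic
   r1^3 r4 = m1, r2^3 r1 = m2, r4^3 r2 = m4 that is invariant under the cyclic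
   shift of the indices. *)
Lemma klein_coordinates r1 (r2 := r1 ^+ 2 / m1) (r4 := r2 ^+ 2 / m2) : r1 ^+ 7 = m1 ^+ 3 * m2 ->
  [/\ r1 * r2 * r4 = 1, r1 ^+ 3 * r4 = m1, r2 ^+ 3 * r1 = m2, r4 ^+ 3 * r2 = m4 & r1 = r4 ^+ 2
      / m4].
Proof.
move=> r7; have m2_neq0 : m2 != 0 by rewrite Dm2 oppr_eq0 invr_eq0.
have Em4 : m4 = (m1 * m2)^-1.
  by apply: (mulfI (mulf_neq0 m1_neq0 m2_neq0)); rewrite shanks_prod mulfV ?mulf_neq0.
rewrite /r4 /r2; split; rewrite ?Em4.
- by field: r7; apply/andP.
- by field: r7; apply/andP.
- by field: r7.
- have r14 : r1 ^+ 14 = (m1 ^+ 3 * m2) ^+ 2 by rewrite -r7 -exprM.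
  by field: r14; apply/andP.
by field: r7; apply/and3P; split=> //; apply: oner_neq0.
Qed.
End Param.
End KleinIdentities.

(** * Evaluation of the septic and the cubic *)

(** The naturals are infinitely many evaluation points, so that polynomial identities reduce to
    identities between values. *)
Lemma horner_ext (R : idomainType) (p q : {poly R}) :
  injective (fun n : nat => n%:R : R) -> (forall z, p.[z] = q.[z]) -> p = q.
Proof.
move=> inj Epq; apply/eqP; rewrite -subr_eq0; apply/negPn/negP=> nz.
pose rs : seq R := [seq i%:R | i <- iota 0 (size (p - q))].
suff: (size rs < size (p - q)%R)%N by rewrite size_map size_iota ltnn.
apply: max_poly_roots => //.
  by apply/allP=> x _; rewrite /root hornerD hornerN Epq subrr.
by rewrite map_inj_uniq ?iota_uniq.
Qed.

Lemma horner_septic (R : fieldType) (f : {rmorphism rat -> R}) t z :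
  (map_poly f (septic t)).[z] = z ^+ 7 - 14 * z ^+ 4 - 7 * (t%:~R - 3) * z ^+ 3
    + 14 * t%:~R * z ^+ 2 - 28 * z + (t%:~R ^+ 2 - 11 * t%:~R + 33).
Proof.
have H c0 c1 c2 c3 c4 : (map_poly f ('X^7 - c4 *: 'X^4 - c3 *: 'X^3 + c2 *: 'X^2 - c1 *: 'X +
    c0%:P)).[z]
    = z ^+ 7 - f c4 * z ^+ 4 - f c3 * z ^+ 3 + f c2 * z ^+ 2 - f c1 * z + f c0.
  rewrite !(rmorphB, rmorphD) /= !map_polyZ !map_polyXn map_polyX map_polyC.
  by rewrite !(hornerD, hornerN, hornerZ, hornerXn, hornerX, hornerC).
rewrite H !(rmorph_nat, rmorph_int); ring.
Qed.

Lemma horner_cubic (R : fieldType) (f : {rmorphism rat -> R}) t z :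
  (map_poly f (cubic t)).[z] =
    z ^+ 3 - t%:~R * z ^+ 2 - (2 * t%:~R ^+ 2 - 7 * t%:~R + 21) * z + (t%:~R ^+ 3 + 28).
Proof.
have H c0 c1 c2 : (map_poly f ('X^3 - c2 *: 'X^2 - c1 *: 'X + c0%:P)).[z]
    = z ^+ 3 - f c2 * z ^+ 2 - f c1 * z + f c0.
  rewrite !(rmorphB, rmorphD) /= !map_polyZ !map_polyXn map_polyX map_polyC.
  by rewrite !(hornerD, hornerN, hornerZ, hornerXn, hornerX, hornerC).
rewrite H !rmorph_int; ring.
Qed.

Lemma horner_deriv_septic (R : fieldType) (f : {rmorphism rat -> R}) t z :
  (map_poly f (septic t))^`().[z] = 7 * z ^+ 6 - 56 * z ^+ 3 - 21 * (t%:~R - 3) * z ^+ 2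
    + 28 * t%:~R * z - 28.
Proof.
have H c0 c1 c2 c3 c4 : (map_poly f ('X^7 - c4 *: 'X^4 - c3 *: 'X^3 + c2 *: 'X^2 - c1 *: 'X +
    c0%:P))^`().[z]
    = 7 * z ^+ 6 - 4 * f c4 * z ^+ 3 - 3 * f c3 * z ^+ 2 + 2 * f c2 * z - f c1.
  rewrite !(rmorphB, rmorphD) /= !map_polyZ !map_polyXn map_polyX map_polyC.
  rewrite !(derivB, derivD, derivZ, derivXn, derivX, derivC).
  rewrite !(hornerD, hornerN, hornerZ, hornerMn, hornerXn, hornerX, hornerC) /=; ring.
rewrite H !(rmorph_nat, rmorph_int); ring.
Qed.

(** * Seventh roots of unity acting on the roots of the septic *)

Section Galois.
Variable C : numClosedFieldType.
Implicit Types (t : int) (y s z : C).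

Let natC_inj : injective (fun n : nat => n%:R : C).
Proof. by move=> m n /eqP; rewrite eqr_nat => /eqP. Qed.

Lemma unity7_sum z : z ^+ 7 = 1 -> z != 1 -> z ^+ 6 = - (z ^+ 5 + z ^+ 4 + z ^+ 3 + z ^+ 2 + z + 1).
Proof.
move=> z7 z1; apply/eqP; rewrite -subr_eq0 opprK; apply/eqP.
have nz : z - 1 != 0 by rewrite subr_eq0.
by apply: (mulfI nz); rewrite mulr0; ring: z7.
Qed.

Lemma unity7_exists : exists2 z : C, z ^+ 7 = 1 & z != 1.
Proof.
(* The constant coefficient function -1 encodes z^6 = - (z^5 + .. + 1). *)
have [|z] := @solve_monicpoly C 6 (fun=> -1) => //.
rewrite !big_ord_recl big_ord0 /= => Dz.
have z6 : z ^+ 6 = - (z ^+ 5 + z ^+ 4 + z ^+ 3 + z ^+ 2 + z + 1) by rewrite Dz; ring.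
exists z; first by ring: z6.
apply: contra_eq_neq z6 => ->; rewrite !expr1n -subr_eq0 opprK.
by have -> : 1 + (1 + 1 + 1 + 1 + 1 + 1) = 7%:R :> C; [ring | rewrite pnatr_eq0].
Qed.

Lemma unity7_exp z x : z ^+ 7 = 1 -> z != 1 -> x ^+ 7 = 1 ->
  x \in [:: 1; z; z ^+ 2; z ^+ 3; z ^+ 4; z ^+ 5; z ^+ 6].
Proof.
move=> z7 z1 x7; have z6 := unity7_sum z7 z1.
have: (x - 1) * ((x - z) * ((x - z ^+ 2) * ((x - z ^+ 3) * ((x - z ^+ 4) * ((x - z ^+ 5) * (x -
    z ^+ 6)))))) = 0.
  by ring: x7 z6.
by move/eqP; rewrite !mulf_eq0 !subr_eq0 !inE.
Qed.

(** The m_i form the orbit of a root m of Shanks' cubic. One of their three cyclic shifts gives y,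
    and relabelling makes it the first; simplicity of the root y separates it from the other two. *)
Lemma shanks_param t a y : a ^+ 7 = 1 -> a != 1 -> root (map_poly ratr (cubic t)) y ->
    ~~ root (map_poly ratr (cubic t))^`() y ->
  exists m1 m2 m4 : C, [/\ m1 * m2 = - 1 - m2, m2 * m4 = - 1 - m4, m4 * m1 = - 1 - m1
     & t%:~R = m1 + m2 + m4 + 3]
   /\ [/\ y = cubic_value m1 m2 m4 a, y != cubic_value m2 m4 m1 a & y != cubic_value m4 m1 m2 a].
Proof.
move=> a7 a1 ry sy; have a6 := unity7_sum a7 a1.
have [m rm] : exists m : C, m ^+ 3 - (t%:~R - 3) * m ^+ 2 - t%:~R * m - 1 = 0.
  have [|m Dm] := @solve_monicpoly C 3 (fun i => [:: 1; t%:~R; t%:~R - 3]`_i) => //.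
  by exists m; rewrite Dm !big_ord_recl big_ord0 /=; ring.
have m_neq0 : m != 0.
  by apply: contra_eq_neq rm => ->; rewrite !expr0n !mulr0 !subr0 add0r oppr_eq0 oner_eq0.
have m1_neq0 : 1 + m != 0.
  rewrite addrC; apply: contra_eq_neq rm => /eqP; rewrite addr_eq0 => /eqP ->.
  have -> : (-1) ^+ 3 - (t%:~R - 3) * (-1) ^+ 2 - t%:~R * (-1) - 1 = 1 :> C by ring.
  exact: oner_neq0.
pose m2 := - (1 + m)^-1; pose m4 := - (1 + m) / m.
have m12 : m * m2 = - 1 - m2 by rewrite /m2; field.
have m24 : m2 * m4 = - 1 - m4 by rewrite /m2 /m4; field; apply/andP.
have m41 : m4 * m = - 1 - m by rewrite /m4; field.
have Dt : t%:~R = m + m2 + m4 + 3.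
  have m1m : m ^+ 2 + m != 0 by rewrite expr2 -{3}[m]mul1r -mulrDl addrC mulf_neq0.
  apply: (mulfI m1m); transitivity (m ^+ 3 + 3 * m ^+ 2 - 1).
    by rewrite -[LHS]add0r -rm; ring.
  by rewrite /m2 /m4; field; apply/andP.
have Ep (n1 n2 n4 : C) (n12 : n1 * n2 = - 1 - n2) (n24 : n2 * n4 = - 1 - n4)
   (n41 : n4 * n1 = - 1 - n1) (Dn : t%:~R = n1 + n2 + n4 + 3) :
   map_poly ratr (cubic t) = ('X - (cubic_value n1 n2 n4 a)%:P) * (('X - (cubic_value n2 n4 n1
       a)%:P) * ('X - (cubic_value n4 n1 n2 a)%:P)).
  by apply: (horner_ext natC_inj) => x; rewrite horner_cubic (cubic_factor n12 n24 n41 Dn x a6)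
      !(hornerM, hornerXsubC) mulrA.
have sep n1 n2 n4 : n1 * n2 = - 1 - n2 -> n2 * n4 = - 1 - n4 -> n4 * n1 = - 1 - n1 ->
    t%:~R = n1 + n2 + n4 + 3 -> y = cubic_value n1 n2 n4 a ->
    exists m1 m2 m4 : C, [/\ m1 * m2 = - 1 - m2, m2 * m4 = - 1 - m4, m4 * m1 = - 1 - m1
     & t%:~R = m1 + m2 + m4 + 3]
   /\ [/\ y = cubic_value m1 m2 m4 a, y != cubic_value m2 m4 m1 a & y != cubic_value m4 m1 m2 a].
  move=> n12 n24 n41 Dn Ey; exists n1, n2, n4; split=> //.
  move: sy; rewrite (Ep _ _ _ n12 n24 n41 Dn) derivM derivXsubC mul1r -Ey rootE !hornerE.
  by rewrite subrr mul0r addr0 mulf_eq0 !subr_eq0 negb_or => /andP[? ?].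
move: ry; rewrite (Ep _ _ _ m12 m24 m41 Dt) !rootM !root_XsubC => /or3P[] /eqP Ey.
- exact: (sep m m2 m4).
- by apply: (sep m2 m4 m) => //; rewrite Dt; ring.
- by apply: (sep m4 m m2) => //; rewrite Dt; ring.
Qed.

(** Here x w is the root w r1 + w^2 r2 + w^4 r4. Of the nine pairs of shifts of [a] and of the m_i
    under nu, six would make y equal to one of its conjugates; the three pairs of equal shifts
    permute r1, r2, r4 cyclically up to seventh roots of unity. *)
Lemma klein_resolvent (t : int) (y s : C) : root (map_poly ratr (cubic t)) y ->
    ~~ root (map_poly ratr (cubic t))^`() y -> s ^+ 2 = - 7 ->
  exists x : C -> C,
    (forall c w, c ^+ 7 = 1 -> c != 1 -> w ^+ 7 = 1 ->
       map_poly ratr (septic t) = \prod_(k < 7) ('X - (x (c ^+ k * w))%:P))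
    /\ (forall nu : {rmorphism C -> C}, nu y = y -> nu s = s ->
       exists2 c, c ^+ 7 = 1 & forall w, w ^+ 7 = 1 -> nu (x w) = x (c * w)).
Proof.
move=> ry sy s2; have [a a7 a1] := unity7_exists.
have [m1 [m2 [m4 [[m12 m24 m41 Dt] [Ey y1 y2]]]]] := shanks_param a7 a1 ry sy.
have a6 := unity7_sum a7 a1; have m124 := shanks_prod m12 m24.
have [m1_nz m2_nz m4_nz] : [/\ m1 != 0, m2 != 0 & m4 != 0].
  split; apply: contra_eq_neq m124 => ->; rewrite ?(mul0r, mulr0) eq_sym; exact: oner_neq0.
pose r1 := 7.-root (m1 ^+ 3 * m2); pose r2 := r1 ^+ 2 / m1; pose r4 := r2 ^+ 2 / m2.
have r7 : r1 ^+ 7 = m1 ^+ 3 * m2 by rewrite rootCK.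
have [R M1 M2 M4 Er1] := klein_coordinates m12 m24 r7; rewrite -/r2 -/r4 in R M1 M2 M4 Er1.
have Dr2 : r2 = r1 ^+ 2 / m1 by []; have Dr4 : r4 = r2 ^+ 2 / m2 by [].
clearbody r4; clearbody r2; clearbody r1.
exists (klein_sum r1 r2 r4); split=> [c w c7 c1 w7|nu nuy nus].
  have c6 := unity7_sum c7 c1.
  apply: (horner_ext natC_inj) => z; rewrite horner_septic horner_prod.
  under eq_bigr => i _ do rewrite hornerXsubC.
  have e2 : (c + c ^+ 2 + c ^+ 4) ^+ 2 = - (c + c ^+ 2 + c ^+ 4) - 2 by ring: c7 c6.
  (* Scaling by (w, w^2, w^4) preserves Klein's quartic and the m_i, so [klein_septic_factor]
     applies to the scaled point. *)
  have R' : (w * r1) * (w ^+ 2 * r2) * (w ^+ 4 * r4) = 1 by rewrite -R; ring: w7.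
  have M1' : (w * r1) ^+ 3 * (w ^+ 4 * r4) = m1 by rewrite -M1; ring: w7.
  have M2' : (w ^+ 2 * r2) ^+ 3 * (w * r1) = m2 by rewrite -M2; ring: w7.
  have M4' : (w ^+ 4 * r4) ^+ 3 * (w ^+ 2 * r2) = m4 by rewrite -M4; ring: w7.
  rewrite -(klein_septic_factor m12 m24 m41 Dt z R' M1' M2' M4' e2).
  (* As 3 is a non-residue modulo 7, the powers c^3, c^6, c^5 belong to the other value - 1 - e. *)
  have c3 : (c ^+ 3) ^+ 6 = - ((c ^+ 3) ^+ 5 + (c ^+ 3) ^+ 4 + (c ^+ 3) ^+ 3 + (c ^+ 3) ^+ 2 +
      c ^+ 3 + 1).
    by ring: c7 c6.
  have -> : - 1 - (c + c ^+ 2 + c ^+ 4) = c ^+ 3 + (c ^+ 3) ^+ 2 + (c ^+ 3) ^+ 4 by ring: c7 c6.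
  rewrite -(klein_cubicE z _ _ _ c6) -(klein_cubicE z _ _ _ c3).
  have XE b : klein_sum (w * r1) (w ^+ 2 * r2) (w ^+ 4 * r4) b = klein_sum r1 r2 r4 (b * w) by
      rewrite /klein_sum; ring.
  have X1 : w * r1 + w ^+ 2 * r2 + w ^+ 4 * r4 = klein_sum r1 r2 r4 (c ^+ 0 * w) by rewrite
      /klein_sum; ring.
  rewrite X1 !XE !big_ord_recl big_ord0 /= /bump /= !add1n.
  have -> : (c ^+ 3) ^+ 2 = c ^+ 6 by ring.
  have -> : (c ^+ 3) ^+ 4 = c ^+ 5 by ring: c7.
  rewrite expr1; set f := fun k => z - klein_sum r1 r2 r4 (c ^+ k * w).
  rewrite -/(f 0) -/(f 1) -/(f 2) -/(f 3) -/(f 4) -/(f 5) -/(f 6).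
  ring.
have a8 : a ^+ 8 = a by rewrite exprS a7 mulr1.
have a16 : a ^+ 16 = a ^+ 2 by rewrite (exprM a 8 2) a8.
(* Fixing s = +-(2 e + 1) forces nu a to be a, a^2 or a^4; fixing y forces nu to
   shift m1, m2, m4 by the same amount. *)
pose e := a + a ^+ 2 + a ^+ 4.
have nue : nu e = e.
  have: (s - (2 * e + 1)) * (s + (2 * e + 1)) = 0 by rewrite /e; ring: s2 a7 a6.
  have two_nz : 2 != 0 :> C by rewrite pnatr_eq0.
  move/eqP; rewrite mulf_eq0 subr_eq0 addr_eq0 => /orP[]/eqP Es; move: nus; rewrite Es ?rmorphN.
    by rewrite rmorphD rmorphM rmorph_nat rmorph1 => /addIr/(mulfI two_nz).
  by rewrite rmorphD rmorphM rmorph_nat rmorph1 => /oppr_inj/addIr/(mulfI two_nz).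
have nua : nu a \in [:: a; a ^+ 2; a ^+ 4].
  have := unity7_exp a7 a1 (_ : nu a ^+ 7 = 1); rewrite -rmorphXn a7 rmorph1 => /(_ erefl).
  have e0 : e ^+ 2 + e + 2 = 0 by rewrite /e; ring: a7 a6.
  have ne : 2 * e + 1 != 0.
    apply/eqP=> e1; have: (2 * e + 1) ^+ 2 = - 7 by rewrite -[RHS]addr0 -(mulr0 4) -e0; ring.
    by rewrite e1 expr0n => /eqP; rewrite eq_sym oppr_eq0 pnatr_eq0.
  (* A non-residue power would exchange e and - 1 - e, which are distinct because (2 e + 1)^2 = -
     7. *)
  have bad : nu a = 1 \/ nu a = a ^+ 3 \/ nu a = a ^+ 5 \/ nu a = a ^+ 6 -> False.
    case=> [Ha|Ha].
      have := fmorph_inj nu; move=> /(_ a 1); rewrite Ha rmorph1 => /(_ erefl) /eqP.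
      by apply/negP.
    have: nu e = - 1 - e.
      by rewrite /e !rmorphD !rmorphXn; case: Ha => [|[]] ->; ring: a7 a6.
    by rewrite nue => e1; case/eqP: ne; rewrite mulr_natl mulr2n {1}e1; ring.
  rewrite !inE => /or4P[/eqP Ha|->|->|] //; first by case: bad; left.
    by rewrite orbT.
  case/or4P=> [/eqP Ha|->|/eqP Ha|/eqP Ha]; rewrite ?orbT //; case: bad; tauto.
have num : nu m1 \in [:: m1; m2; m4].
  have E x : (x - m1) * ((x - m2) * (x - m4)) = x ^+ 3 - (t%:~R - 3) * x ^+ 2 - t%:~R * x - 1.
    by rewrite (shanks_factor m12 m24 m41 Dt) mulrA.
  have: (nu m1 - m1) * ((nu m1 - m2) * (nu m1 - m4)) = 0.
    rewrite E; transitivity (nu ((m1 - m1) * ((m1 - m2) * (m1 - m4)))).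
      by rewrite E !(rmorphB, rmorphM, rmorphXn, rmorph_int, rmorph1, rmorph_nat).
    by rewrite subrr mul0r rmorph0.
  by move/eqP; rewrite !mulf_eq0 !subr_eq0 !inE.
(* The relation (n + 1) x = - 1 determines x, so nu m1 determines nu m2 and nu m4. *)
have uniqm n x z : n * x = - 1 - x -> n * z = - 1 - z -> x = z.
  move=> nx nz; have n1 : n + 1 != 0.
    apply/eqP=> n10; have: (n + 1) * x = - 1 by rewrite mulrDl nx mul1r; ring.
    by rewrite n10 mul0r => /eqP; rewrite eq_sym oppr_eq0 oner_eq0.
  by apply: (mulfI n1); rewrite !mulrDl nx nz; ring.
have nuR x z : x * z = - 1 - z -> nu x * nu z = - 1 - nu z.
  by move/(congr1 nu); rewrite rmorphM rmorphB rmorphN rmorph1.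
have [num2 num4] := (nuR _ _ m12, nuR _ _ m24).
have nuY : y = cubic_value (nu m1) (nu m2) (nu m4) (nu a).
  rewrite -{1}nuy Ey /cubic_value /cosine2 !(rmorphB, rmorphD, rmorphM, rmorphXn, rmorph1).
  by [].
have nuX k : nu a = a ^+ k -> forall w, w ^+ 7 = 1 -> nu w = w ^+ k.
  move=> nuak w /(unity7_exp a7 a1); rewrite !inE.
  by do ![case/predU1P=> [->|]]; try move/eqP->; rewrite ?rmorph1 ?expr1n ?rmorphXn /= ?nuak //
      exprAC.
have nur : nu r1 ^+ 7 = nu m1 ^+ 3 * nu m2 by rewrite -rmorphXn r7 rmorphM rmorphXn.
have nur2 : nu r2 = nu r1 ^+ 2 / nu m1 by rewrite Dr2 fmorph_div rmorphXn.
have nur4 : nu r4 = nu r2 ^+ 2 / nu m2 by rewrite Dr4 fmorph_div rmorphXn.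
have cyc r : r != 0 -> nu r1 ^+ 7 = r ^+ 7 -> exists2 c, c ^+ 7 = 1 & nu r1 = c * r.
  move=> nz E; exists (nu r1 / r); last by rewrite mulfVK.
  by rewrite expr_div_n E mulfV ?expf_neq0.
have r1_nz : r1 != 0 by apply: contra_eq_neq R => ->; rewrite !mul0r eq_sym oner_neq0.
have r2_nz : r2 != 0 by rewrite Dr2 mulf_neq0 ?invr_eq0 ?expf_neq0.
have r4_nz : r4 != 0 by rewrite Dr4 mulf_neq0 ?invr_eq0 ?expf_neq0.
move: nua; rewrite !inE => /or3P[]/eqP nua.
- have {}nuX w : w ^+ 7 = 1 -> nu w = w by apply: (nuX 1); rewrite expr1.
  move: num; rewrite !inE => /or3P[]/eqP num1; rewrite num1 in num2 nuY nur nur2.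
  + have num2' := uniqm _ _ _ num2 m12; rewrite num2' in num4 nuY nur nur4.
    have [c c7 cE] := cyc r1 r1_nz (etrans nur (esym r7)).
    have nr2 : nu r2 = c ^+ 2 * r2 by rewrite nur2 cE Dr2; field.
    have nr4 : nu r4 = c ^+ 4 * r4 by rewrite nur4 nr2 Dr4; field.
    exists c => // w w7; rewrite /klein_sum !(rmorphD, rmorphM, rmorphXn) nuX // nr4 nr2 cE.
    by ring.
  + have num2' := uniqm _ _ _ num2 m24; rewrite num2' in num4 nuY.
    have num4' := uniqm _ _ _ num4 m41; rewrite num4' nua in nuY.
    by rewrite -nuY eqxx in y1.
  + have num2' := uniqm _ _ _ num2 m41; rewrite num2' in num4 nuY.
    have num4' := uniqm _ _ _ num4 m12; rewrite num4' nua in nuY.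
    by rewrite -nuY eqxx in y2.
- move: num; rewrite !inE => /or3P[]/eqP num1; rewrite num1 in num2 nuY nur nur2.
  + have num2' := uniqm _ _ _ num2 m12; rewrite num2' in num4 nuY nur nur4.
    have num4' := uniqm _ _ _ num4 m24; rewrite num4' nua in nuY.
    have Y : cubic_value m1 m2 m4 (a ^+ 2) = cubic_value m4 m1 m2 a by rewrite /cubic_value
        -!exprM ?a8 ?a16; ring.
    by rewrite -Y -nuY eqxx in y2.
  + have num2' := uniqm _ _ _ num2 m24; rewrite num2' in num4 nuY nur nur4.
    have E : m2 ^+ 3 * m4 = r2 ^+ 7 by rewrite -[RHS]mulr1 -[1](expr1n _ 3) -R -M2 -M4; ring.
    have [c c7 cE] := cyc r2 r2_nz (etrans nur E).
    (* The multiplier is the factor of w r1 in nu (x w): nu sends r4 to c^4 r1 and w^4 to w^8 =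
       w. *)
    exists (c ^+ 4); first by ring: c7.
    move=> w w7; rewrite /klein_sum !(rmorphD, rmorphM, rmorphXn) (nuX 2) //.
    have nr2 : nu r2 = c ^+ 2 * r4 by rewrite nur2 cE Dr4; field.
    have -> : nu r4 = c ^+ 4 * r1 by rewrite nur4 nr2 Er1; field.
    by rewrite nr2 cE; ring: c7 w7.
  + have num2' := uniqm _ _ _ num2 m41; rewrite num2' in num4 nuY.
    have num4' := uniqm _ _ _ num4 m12; rewrite num4' nua in nuY.
    have Y : cubic_value m4 m1 m2 (a ^+ 2) = cubic_value m2 m4 m1 a by rewrite /cubic_value
        -!exprM ?a8 ?a16; ring.
    by rewrite -Y -nuY eqxx in y1.
move: num; rewrite !inE => /or3P[]/eqP num1; rewrite num1 in num2 nuY nur nur2.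
+ have num2' := uniqm _ _ _ num2 m12; rewrite num2' in num4 nuY.
  have num4' := uniqm _ _ _ num4 m24; rewrite num4' nua in nuY.
  have Y : cubic_value m1 m2 m4 (a ^+ 4) = cubic_value m2 m4 m1 a by rewrite /cubic_value
      -!exprM ?a8 ?a16; ring.
  by rewrite -Y -nuY eqxx in y1.
+ have num2' := uniqm _ _ _ num2 m24; rewrite num2' in num4 nuY.
  have num4' := uniqm _ _ _ num4 m41; rewrite num4' nua in nuY.
  have Y : cubic_value m2 m4 m1 (a ^+ 4) = cubic_value m4 m1 m2 a by rewrite /cubic_value
      -!exprM ?a8 ?a16; ring.
  by rewrite -Y -nuY eqxx in y2.
have num2' := uniqm _ _ _ num2 m41; rewrite num2' in num4 nuY nur nur4.
have E : m4 ^+ 3 * m1 = r4 ^+ 7 by rewrite -[RHS]mulr1 -[1](expr1n _ 3) -R -M1 -M4; ring.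
have [c c7 cE] := cyc r4 r4_nz (etrans nur E).
(* Here it is r2 that goes to c^2 r1, while w^2 goes to w^8 = w. *)
exists (c ^+ 2); first by ring: c7.
move=> w w7; rewrite /klein_sum !(rmorphD, rmorphM, rmorphXn) (nuX 4) //.
have nr2 : nu r2 = c ^+ 2 * r1 by rewrite nur2 cE Er1; field.
rewrite nr2; have -> : nu r4 = c ^+ 4 * r2 by rewrite nur4 nr2 Dr2; field.
by rewrite cE; ring: c7 w7.
Qed.
End Galois.

(** * Separability and the Galois group of the septic *)

Lemma irreducible_separable (R : numFieldType) (p : {poly R}) :
  irreducible_poly p -> separable_poly p.
Proof.
move=> irr; have [sp _] := irr; rewrite unlock irreducible_poly_coprime //.
have p_nz : p != 0 by rewrite -size_poly_gt0 ltnW.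
have dp_nz : p^`() != 0.
  apply/eqP=> /polyP/(_ (size p).-2); rewrite coef_deriv coef0 => /eqP.
  rewrite -mulr_natr mulf_eq0 pnatr_eq0 orbF.
  by rewrite (_ : (size p).-2.+1 = (size p).-1) ?lead_coef_eq0 ?(negPf p_nz) //; case: size sp
      => [|[|]].
by apply/negP=> /(dvdp_leq dp_nz); rewrite leqNgt lt_size_deriv.
Qed.

Section SepticGalois.
Variables (t : int) (L : splittingFieldType rat) (y s : L) (K E : {subfield L}).
Hypotheses (irr3 : irreducible_poly (cubic t)) (irr7 : irreducible_poly (septic t)).
Hypotheses (ry : root (map_poly (in_alg L) (cubic t)) y) (s2 : s ^+ 2 = - 7).
Hypotheses (Ky : y \in K) (Ks : s \in K).
Hypothesis splitE : splittingFieldFor K (map_poly (in_alg L) (septic t)) E.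

Lemma septic_galois : galois K E.
Proof.
apply/splitting_galoisField; exists (map_poly (in_alg L) (septic t)).
by rewrite alg_polyOver separable_map irreducible_separable.
Qed.

(** The fixed field of g h^-1 contains K and [rs], hence E. *)
Lemma gal_eq_on_gens (rs : seq L) (g h : gal_of E) : <<K & rs>>%VS = E ->
  g \in 'Gal(E / K)%g -> h \in 'Gal(E / K)%g -> {in rs, g =1 h} -> g = h.
Proof.
move=> DE Gg Gh Egh; have sKE : (K <= E)%VS by rewrite -DE subv_adjoin_seq.
have rsE r : r \in rs -> r \in E by move=> rr; rewrite -DE seqv_sub_adjoin.
pose x := (g * h^-1)%g; suff fE : (E <= fixedField [set x])%VS.
  apply/eqP; rewrite eq_mulgV1; apply/eqP/eqP/gal_eqP=> a Ea.
  by rewrite gal_id; have /mem_fixedFieldP[_ ->] := subvP fE a Ea; rewrite ?inE.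
rewrite -{1}DE; apply/Fadjoin_seqP; split=> [|r rr].
  apply/subvP=> a Ka; apply/fixedFieldP; first exact: (subvP sKE).
  by move=> _ /set1P->; rewrite (fixed_gal sKE) // groupM ?groupV.
apply/fixedFieldP; first exact: rsE.
by move=> _ /set1P->; rewrite galM ?rsE // Egh // -galM ?rsE // mulgV gal_id.
Qed.

(** In [algC] the roots are the x w, and g, extended to an automorphism of [algC], acts by w |-> c
    w. Since c determines g, any g <> 1 has c of order 7, and the powers of g reach every
    automorphism and every root. *)
Lemma septic_cyclic : cyclic 'Gal(E / K)%g
  /\ forall g, g \in 'Gal(E / K)%g -> g != 1%g -> forall th, root (map_poly (in_alg L) (septic
      t)) th ->
     map_poly (in_alg L) (septic t) = \prod_(k < 7) ('X - ((g ^+ k)%g th)%:P).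
Proof.
have [f [fB fM]] := num_field_embedding L.
pose fBm := GRing.isZmodMorphism.Build _ _ f fB.
pose fMm := GRing.isMonoidMorphism.Build _ _ f fM.
pose iota : {rmorphism L -> algC} := HB.pack f fBm fMm.
clearbody iota => {fBm fMm fB fM f}.
have iotaE p : map_poly iota (map_poly (in_alg L) p) = map_poly ratr p.
  by rewrite -map_poly_comp; apply: eq_map_poly => a; rewrite (fmorph_eq_rat (iota \o in_alg L)).
have ryC : root (map_poly ratr (cubic t)) (iota y) by rewrite -iotaE fmorph_root.
have syC : ~~ root (map_poly ratr (cubic t))^`() (iota y).
  have := irreducible_separable irr3; rewrite unlock => sep.
  by apply: (coprimep_root _ ryC); rewrite deriv_map coprimep_map.
have sC : iota s ^+ 2 = - 7 by rewrite -rmorphXn s2 rmorphN rmorph_nat.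
have [x [xP xG]] := klein_resolvent ryC syC sC.
case: splitE => rs Drs DE.
have sKE : (K <= E)%VS by rewrite -DE subv_adjoin_seq.
have [a a7 a1] := @unity7_exists algC.
have rootx th : root (map_poly (in_alg L) (septic t)) th -> exists2 w, w ^+ 7 = 1 & iota th = x w.
  rewrite -(fmorph_root iota) iotaE (xP a 1) ?expr1n // rootE horner_prod.
  case/prodf_eq0=> k _; rewrite hornerXsubC subr_eq0 => /eqP->; exists (a ^+ k * 1) => //.
  by rewrite mulr1 exprAC a7 expr1n.
have rsE r : root (map_poly (in_alg L) (septic t)) r = (r \in rs).
  by rewrite (eqp_root Drs) root_prod_XsubC.
have rsinE r : r \in rs -> r \in E by move=> rr; rewrite -DE seqv_sub_adjoin.
have shift g : g \in 'Gal(E / K)%g -> exists2 c, c ^+ 7 = 1 &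
    forall th w, w ^+ 7 = 1 -> iota th = x w -> iota (g th) = x (c * w).
  move=> Gg; have [nu Dnu] := extend_algC_subfield_aut iota (gal_repr g).
  have [||c c7 Hc] := xG nu.
  - by rewrite -Dnu /= (fixed_gal sKE).
  - by rewrite -Dnu /= (fixed_gal sKE).
  by exists c => // th w w7 Dth; rewrite Dnu Dth Hc.
have shiftX g c : g \in 'Gal(E / K)%g -> c ^+ 7 = 1 ->
    (forall th w, w ^+ 7 = 1 -> iota th = x w -> iota (g th) = x (c * w)) ->
  forall (k : nat) th w, th \in E -> w ^+ 7 = 1 -> iota th = x w -> iota ((g ^+ k)%g th) = x (c
      ^+ k * w).
  move=> Gg c7 Hg; elim=> [|k IH] th w Eth w7 Dth; first by rewrite gal_id mul1r.
  rewrite expgSr galM // exprS -mulrA; apply: Hg; last exact: IH.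
  by rewrite exprMn exprAC c7 w7 expr1n mulr1.
have c_neq1 g c : g \in 'Gal(E / K)%g -> g != 1%g ->
    (forall th w, w ^+ 7 = 1 -> iota th = x w -> iota (g th) = x (c * w)) -> c != 1.
  move=> Gg g1 Hg; apply: contraNneq g1 => c1; apply/eqP.
  apply: (gal_eq_on_gens DE) => // r; rewrite -rsE => /rootx[w w7 Dr].
  by apply: (fmorph_inj iota); rewrite gal_id (Hg _ w) // c1 mul1r.
split=> [|g Gg g1 th rth].
  have [-> | /trivgPn[g Gg g1]] := eqVneq 'Gal(E / K)%g 1%g; first exact: cyclic1.
  apply: cyclicS (cycle_cyclic g); apply/subsetP=> h Gh.
  have [c c7 Hg] := shift g Gg; have [d d7 Hh] := shift h Gh.
  have c1 := c_neq1 g c Gg g1 Hg.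
  have [k Dd] : exists k : nat, d = c ^+ k.
    have := unity7_exp c7 c1 d7; rewrite !inE -[1](expr0 c) -{2}[c]expr1.
    by do ![case/predU1P=> [->|]]; try move/eqP->; eexists; reflexivity.
  suff -> : h = (g ^+ k)%g by rewrite mem_cycle.
  apply: (gal_eq_on_gens DE) => //; first by rewrite groupX.
  move=> r; rewrite -rsE => rr; have [w w7 Dr] := rootx r rr.
  apply: (fmorph_inj iota); rewrite (Hh _ w) // (shiftX g c Gg c7 Hg k _ w) ?Dd //.
  by rewrite rsinE // -rsE.
have [w w7 Dth] := rootx th rth; have [c c7 Hg] := shift g Gg.
have c1 := c_neq1 g c Gg g1 Hg.
have thE : th \in E by rewrite rsinE // -rsE.
apply: (map_poly_inj iota); rewrite iotaE (xP c w) // rmorph_prod.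
apply: eq_bigr => k _; rewrite /= map_polyXsubC.
by rewrite (shiftX g c Gg c7 Hg k _ w).
Qed.
End SepticGalois.

(** * Cyclicity of the cubic field *)

(** The discriminant is a square, so the other two roots lie in Q(y), and the group has prime order
    3. *)
Lemma cubic_cyclic (t : int) (L : splittingFieldType rat) (y : L) :
  irreducible_poly (cubic t) -> root (map_poly (in_alg L) (cubic t)) y ->
  cyclic_extension 1%AS <<1; y>>%AS.
Proof.
move=> irr ry; pose T : L := t%:~R; pose A := in_alg L.
(* The derivative of the cubic at y, i.e. (y - y2) (y - y3) for the other two roots. *)
pose q := 3 * y ^+ 2 - 2 * T * y - (2 * T ^+ 2 - 7 * T + 21).
have fy : y ^+ 3 - T * y ^+ 2 - (2 * T ^+ 2 - 7 * T + 21) * y + (T ^+ 3 + 28) = 0.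
  by rewrite -(rootP ry) horner_cubic.
have natL n : (n%:R == 0 :> L) = (n == 0).
  by rewrite -(rmorph_nat A) fmorph_eq0 pnatr_eq0.
have inj : injective (fun n : nat => n%:R : L).
  by move=> m n; rewrite -!(rmorph_nat A) => /fmorph_inj/eqP; rewrite eqr_nat => /eqP.
have q_nz : q != 0.
  have := irreducible_separable irr; rewrite unlock => sep.
  have : coprimep (map_poly A (cubic t)) (map_poly A (cubic t))^`() by rewrite deriv_map
      coprimep_map.
  move=> /coprimep_root /(_ ry).
  have -> : map_poly A (cubic t) = 'X^3 - T *: 'X^2 - (2 * T ^+ 2 - 7 * T + 21) *: 'X + (T ^+ 3
      + 28)%:P.
    apply: (horner_ext inj) => z; rewrite horner_cubic.
    by rewrite !(hornerD, hornerN, hornerZ, hornerXn, hornerX, hornerC).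
  by rewrite !(derivD, derivN, derivZ, derivXn, derivX, derivC) !(hornerD, hornerN, hornerZ,
      hornerMn, hornerXn, hornerX, hornerC) /q; congr (_ != 0); ring.
have two : 2 != 0 :> L by rewrite natL.
(* d is a square root of the discriminant of the cubic. *)
pose d := 7 * (T - 2) * (T ^+ 2 - 3 * T + 9).
(* The quadratic formula for the remaining factor, with d / q = y3 - y2. *)
pose y2 := (T - y - d / q) / 2; pose y3 := (T - y + d / q) / 2.
have e1 : y + y2 + y3 = T by rewrite /y2 /y3; field; apply/andP.
have e2 : y2 * y3 = y ^+ 2 - T * y - (2 * T ^+ 2 - 7 * T + 21).
  pose fz := y ^+ 3 - T * y ^+ 2 - (2 * T ^+ 2 - 7 * T + 21) * y + (T ^+ 3 + 28).
  have D2 : d ^+ 2 = q ^+ 2 * ((T - y) ^+ 2 - 4 * (y ^+ 2 - T * y - (2 * T ^+ 2 - 7 * T + 21))).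
    rewrite /d /q. 
    have y3E : y ^+ 3 = T * y ^+ 2 + (2 * T ^+ 2 - 7 * T + 21) * y - (T ^+ 3 + 28).
      by rewrite -[RHS]addr0 -fy; ring.
    ring: y3E.
  have -> : y2 * y3 = ((T - y) ^+ 2 - d ^+ 2 / q ^+ 2) / 4 by rewrite /y2 /y3; field; rewrite
      ?natL ?q_nz ?two.
  by rewrite D2; field; rewrite q_nz natL.
have split3 : map_poly A (cubic t) = \prod_(z <- [:: y; y2; y3]) ('X - z%:P).
  rewrite !big_cons big_nil mulr1.
  apply: (horner_ext inj) => z; rewrite horner_cubic !(hornerM, hornerXsubC) -/T.
  have -> : (z - y2) * (z - y3) = z ^+ 2 - (T - y) * z + y2 * y3 by rewrite -e1; ring.
  by rewrite e2 -[LHS]subr0 -fy; ring.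
pose M : {subfield L} := <<1; y>>%AS.
have Ey : y \in M := memv_adjoin _ _.
have ET : T \in M by apply: rpred_int.
have Eq : q \in M by do ?[exact: rpred_nat | apply: rpredB | apply: rpredD | apply: rpredM |
    apply: rpredX].
have Ed : d / q \in M.
  by apply: rpred_div => //; do ?[exact: rpred_nat | apply: rpredB | apply: rpredD | apply:
      rpredM | apply: rpredX].
have gal3 : galois 1 <<1; y>>.
  apply/splitting_galoisField; exists (map_poly A (cubic t)).
  split; first exact: alg_polyOver.
    by rewrite separable_map irreducible_separable.
  exists [:: y; y2; y3]; first by rewrite split3 eqpxx.
  apply/eqP; rewrite eqEsubv; apply/andP; split.
    apply/(@Fadjoin_seqP _ _ 1%AS _ M); split=> [|z]; first exact: subv_adjoin.
    rewrite !inE => /or3P[]/eqP-> //; apply: rpred_div; try exact: rpred_nat.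
      by do ?apply: rpredB.
    by apply: rpredD => //; apply: rpredB.
  by rewrite sub_adjoin1v seqv_sub_adjoin ?mem_head.
rewrite /cyclic_extension gal3 /=; apply: prime_cyclic.
rewrite -galois_dim //.
have [r Dr] : exists r : {poly rat}, minPoly 1 y = map_poly A r.
  by have /polyOver1P[r ->] := minPolyOver 1%AS y; exists r.
have Sr := size_minPoly 1%AS y; rewrite Dr size_map_poly adjoin_degreeE in Sr.
have Sc : size (cubic t) = 4%N by rewrite -(size_map_poly A) split3 size_prod_XsubC.
have: r %| cubic t by rewrite -(dvdp_map A) -Dr minPoly_dvdp ?alg_polyOver.
case: irr => _ /(_ r) irr /irr; rewrite Sr eqSS -lt0n ltn_divRL ?dvd1n ?dimv1 //.
rewrite mul0n adim_gt0 => /(_ isT) /eqp_size; rewrite Sr Sc => -[E].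
by move: E; rewrite dimv1 /= => ->.
Qed.

(** * Rings of integers and their prime ideals *)

Section IntegerRing.
Variables (L : fieldExtType rat) (E : {subfield L}).
Local Notation A := (ring_of_integers E).

Lemma roi_int (n : int) : A n%:~R.
Proof. by split; [apply: rpred_int | apply: integral_id]. Qed.

Lemma roi0 : A 0. Proof. exact: (roi_int 0). Qed.
Lemma roi1 : A 1. Proof. exact: (roi_int 1). Qed.

Lemma roiD x y : A x -> A y -> A (x + y).
Proof. by move=> [Ex Ix] [Ey Iy]; split; [apply: rpredD | apply: integral_add]. Qed.

Lemma roiM x y : A x -> A y -> A (x * y).
Proof. by move=> [Ex Ix] [Ey Iy]; split; [apply: rpredM | apply: integral_mul]. Qed.

Lemma roiN x : A x -> A (- x).
Proof. by move=> [Ex Ix]; split; [rewrite rpredN | apply: integral_opp]. Qed.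

Lemma roiB x y : A x -> A y -> A (x - y).
Proof. by move=> Ax Ay; apply: roiD (roiN _). Qed.

Lemma roi_horner (p : {poly int}) x : A x -> A (map_poly intr p).[x].
Proof.
move=> Ax; elim/poly_ind: p => [|p c IH]; first by rewrite rmorph0 horner0; apply: roi0.
rewrite rmorphD rmorphM /= map_polyX map_polyC hornerMXaddC.
by apply: roiD (roi_int c); apply: roiM.
Qed.

Section Ideal.
Variable I : L -> Prop.
Hypothesis idI : is_ideal A I.

Lemma idl_roi x : I x -> A x. Proof. by case: idI => + _ _ _; apply. Qed.
Lemma idl_zero : I 0. Proof. by case: idI. Qed.
Lemma idl_add x y : I x -> I y -> I (x + y). Proof. by case: idI => _ _ + _; apply. Qed.
Lemma idl_mull a x : A a -> I x -> I (a * x). Proof. by case: idI => _ _ _; apply. Qed.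
Lemma idl_mulr a x : A a -> I x -> I (x * a). Proof. by rewrite mulrC; apply: idl_mull. Qed.
Lemma idl_opp x : I x -> I (- x).
Proof. by rewrite -mulN1r; apply: idl_mull; apply: roiN roi1. Qed.
Lemma idl_sub x y : I x -> I y -> I (x - y).
Proof. by move=> Ix Iy; apply: idl_add (idl_opp _). Qed.
Lemma idl_sum (T : eqType) (s : seq T) (F : T -> L) :
  (forall i, i \in s -> I (F i)) -> I (\sum_(i <- s) F i).
Proof. by move=> IF; rewrite big_seq; apply: big_ind => //; [apply: idl_zero | apply: idl_add]. Qed.
End Ideal.

Lemma roi_ideal : is_ideal A A.
Proof. by split=> //; [apply: roi0 | apply: roiD | apply: roiM]. Qed.

Lemma ideal_mul_ideal I J : is_ideal A I -> is_ideal A J -> is_ideal A (ideal_mul I J).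
Proof.
move=> idI idJ; split.
- move=> _ [s sIJ ->]; apply: (idl_sum roi_ideal) => u /sIJ[Iu Ju].
  by apply: roiM; [apply: (idl_roi idI) | apply: (idl_roi idJ)].
- by exists [::] => //; rewrite big_nil.
- move=> _ _ [s sIJ ->] [s' sIJ' ->]; exists (s ++ s'); last by rewrite big_cat.
  by move=> u; rewrite mem_cat => /orP[/sIJ | /sIJ'].
move=> a _ Aa [s sIJ ->]; exists [seq (a * u.1, u.2) | u <- s].
  by move=> _ /mapP[u /sIJ[Iu Ju] ->]; split=> //; apply: (idl_mull idI).
by rewrite mulr_sumr big_map; apply: eq_bigr => u _; rewrite mulrA.
Qed.

Lemma ideal_mul_subl I J : is_ideal A I -> pred_sub J A -> pred_sub (ideal_mul I J) I.
Proof.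
move=> idI JA _ [s sIJ ->]; apply: (idl_sum idI) => u /sIJ[Iu Ju].
by apply: (idl_mulr idI) => //; apply: JA.
Qed.

Lemma mem_ideal_mul (I J : L -> Prop) x y : I x -> J y -> ideal_mul I J (x * y).
Proof. by move=> Ix Jy; exists [:: (x, y)]; [move=> u /[!inE]/eqP-> | rewrite big_seq1]. Qed.

Section PrimeIdeal.
Variable P : L -> Prop.
Hypothesis primeP : is_prime_ideal A P.
Let idP : is_ideal A P. Proof. by case: primeP. Qed.

(** The constant term of a monic integral equation of x is a multiple of x; factors X are removed
    until it is nonzero. *)
Lemma prime_ideal_int x : x != 0 -> P x -> exists2 n : int, n != 0 & P n%:~R.
Proof.
move=> x_nz Px; have [_ [p]] := idl_roi idP Px.
elim/poly_ind: p => [|p c IH]; first by rewrite monicE lead_coef0 eq_sym oner_eq0.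
rewrite rmorphD rmorphM /= map_polyX map_polyC => mon /rootP; rewrite hornerMXaddC /= => pc.
have [c0|c_nz] := eqVneq c 0.
  apply: IH; first by move: mon; rewrite c0 addr0 !monicE lead_coefMX.
  by move/eqP: pc; rewrite c0 /= mulr0z addr0 mulf_eq0 (negPf x_nz) orbF.
exists c => //; move/eqP: pc; rewrite addrC addr_eq0 => /eqP->.
apply: (idl_opp idP); apply: (idl_mull idP) => //; apply: roi_horner.
exact: (idl_roi idP Px).
Qed.

(** Provides the residue characteristic: a positive integer in P is divided by its least prime
    factor until that factor lies in P. *)
Lemma prime_ideal_prime x : x != 0 -> P x -> exists2 l, prime l & P l%:R.
Proof.
move=> x_nz /(prime_ideal_int x_nz)[n n_nz Pn].
have {}Pn : P `|n|%N%:R.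
  have: P (sgz n * n)%:~R by rewrite rmorphM; apply: (idl_mull idP (roi_int _)).
  by rewrite -abszEsg.
have : (0 < `|n|)%N by rewrite absz_gt0.
elim/ltn_ind: `|n|%N Pn => m IH Pm m_gt0.
case: (ltngtP m 1) => [|m_gt1|m1]; first by case: (m) m_gt0.
  move: Pm; rewrite -(divnK (pdiv_dvd m)) natrM => Pm.
  case: primeP => _ _ /(_ _ _ _ _ Pm)[||Pd|Pd].
  - exact: (roi_int (m %/ pdiv m)%N).
  - exact: (roi_int (pdiv m)).
  - apply: IH Pd _; first by rewrite ltn_Pdiv ?prime_gt1 ?pdiv_prime.
    by rewrite divn_gt0 ?pdiv_leq ?pdiv_gt0.
  by exists (pdiv m) => //; apply: pdiv_prime.
by case: primeP => _ P1 _; case: P1; rewrite m1 in Pm.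
Qed.

(* Among the monic integral polynomials taking a value in P at x, one of least
   degree has a constant term prime to l, which inverts x modulo P. *)
Lemma prime_ideal_maximal l x : prime l -> P l%:R -> A x -> ~ P x ->
  exists2 x', A x' & P (1 - x * x').
Proof.
move=> pr_l Pl Ax Px; have [p mon rp] := Ax.2.
have: P (map_poly intr p).[x] by rewrite (rootP rp); apply: (idl_zero idP).
elim/poly_ind: p mon {rp} => [|p c IH mon].
  by rewrite monicE lead_coef0 eq_sym oner_eq0.
rewrite rmorphD rmorphM /= map_polyX map_polyC hornerMXaddC /= => Ppc.
have [p0|p_nz] := eqVneq p 0.
  move: mon Ppc; rewrite p0 mul0r add0r monicE lead_coefC => /eqP->.
  by rewrite rmorph0 horner0 mul0r add0r; case: primeP.
(* If l divides c, then P contains p(x) x, hence p(x), and p has smaller degree. *)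
have [/dvdzP[d Dc]|ndvd] := boolP (l %| c)%Z.
  have Apx := roi_horner p Ax.
  apply: IH; first by move: mon; rewrite !monicE lead_coefDl ?lead_coefMX // size_polyC
      size_mulX //; case: (c != 0); rewrite // ltnS lt0n size_poly_eq0.
  have {}Ppc : P ((map_poly intr p).[x] * x).
    rewrite -[X in P X](addrK c%:~R); apply: (idl_sub idP Ppc).
    by rewrite Dc rmorphM; apply: (idl_mull idP (roi_int _)).
  by case: primeP => _ _ /(_ _ _ Apx Ax Ppc)[].
have [u [v Duv]] : exists u v : int, u * c + v * l%:Z = 1.
  have cop : coprimez c l by rewrite coprimez_sym /coprimez /gcdz eqz_nat -[_ == _]/(coprime _
      _) prime_coprime.
  by have [[u v] <-] := coprimezP _ _ cop; exists u, v.
(* Modulo P, x p(x) = - c and u c = 1, so - u p(x) is inverse to x. *)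
exists (- u%:~R * (map_poly intr p).[x]).
  by apply: roiM (roi_horner _ Ax); apply: roiN (roi_int _).
have -> : 1 - x * (- u%:~R * (map_poly intr p).[x])
    = u%:~R * ((map_poly intr p).[x] * x + c%:~R) + v%:~R * l%:R.
  have D : u%:~R * c%:~R + v%:~R * l%:R = 1 :> L by rewrite -[l%:R]/(l%:Z%:~R) -!intrM -intrD Duv.
  by rewrite -[X in X - _]D; ring.
by apply: (idl_add idP); apply: (idl_mull idP (roi_int _)).
Qed.
End PrimeIdeal.
End IntegerRing.

(** * Finite generation modulo a prime number *)

Section FiniteGeneration.
Variables (L : fieldExtType rat) (E : {subfield L}) (l : nat).
Hypothesis pr_l : prime l.
Local Notation A := (ring_of_integers E).

(** For [gs] in A, this is linear independence of the classes in the F_l-space A / l A. *)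
Definition indep_mod (gs : seq L) := forall n : 'I_(size gs) -> int,
  (exists2 o, A o & \sum_i (n i)%:~R * gs`_i = l%:R * o) -> forall i, (l %| n i)%Z.

Lemma natL_eq0 n : (n%:R == 0 :> L) = (n == 0).
Proof. by rewrite -(rmorph_nat (in_alg L)) fmorph_eq0 pnatr_eq0. Qed.

(** Bounds the length of such families by the dimension of L. Denominators are cleared, and integral
    relations succumb to descent. *)
Lemma indep_mod_free gs : indep_mod gs -> free gs.
Proof.
move=> ind; have l_nz : l%:R != 0 :> L by rewrite natL_eq0 -lt0n prime_gt0.
(* Descent: an integral relation has all its coefficients divisible by l, and
   can be divided by l. *)
have intrel N (n : 'I_(size gs) -> int) : (\sum_i `|n i| <= N)%N ->
    \sum_i (n i)%:~R * gs`_i = 0 -> forall i, n i = 0.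
  elim: N n => [|N IH] n leN n0 i.
    by move: leN; rewrite leqn0 sum_nat_eq0 => /forallP/(_ i); rewrite absz_eq0 => /eqP.
  have dv : forall i, (l %| n i)%Z by apply: ind; exists 0; [apply: roi0 | rewrite mulr0].
  have Dn j : n j = (n j %/ l)%Z * l by rewrite divzK.
  rewrite Dn (IH (fun j => n j %/ l)%Z) ?mul0r //.
    have [/eqP|s_gt0] := posnP (\sum_i `|n i|)%N.
      rewrite sum_nat_eq0 => /forallP n_0; rewrite big1 // => j _.
      by have := n_0 j; rewrite absz_eq0 => /eqP->; rewrite div0z.
    rewrite -ltnS; apply: leq_trans leN.
    have -> : (\sum_i `|n i| = (\sum_i `|(n i %/ l)%Z|) * l)%N.
      by rewrite big_distrl; apply: eq_bigr => j _; rewrite {1}Dn abszM.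
    rewrite -[X in (X < _)%N]muln1 ltn_mul2l prime_gt1 // andbT lt0n.
    apply: contraTneq s_gt0 => s0; rewrite -leqNgt leqn0 sum_nat_eq0.
    apply/forallP=> j; move/eqP: s0; rewrite sum_nat_eq0 => /forallP/(_ j).
    by rewrite !absz_eq0 => /eqP q0; rewrite Dn q0 mul0r.
  apply: (mulIf l_nz); rewrite mul0r -[RHS]n0 mulr_suml; apply: eq_bigr => j _.
  by rewrite [in RHS]Dn intrM; ring.
rewrite -[gs]/(val (in_tuple gs)); apply/freeP => k k0 i.
pose D := \prod_j denq (k j); pose n i := numq (k i) * \prod_(j | j != i) denq (k j).
have D_nz : D != 0 by apply/prodf_neq0=> j _; apply: denq_neq0.
have Dn j : (n j)%:~R = k j * D%:~R.
  by rewrite /D (bigD1 j) //= !intrM mulrA -{2}[k j]divq_num_den mulfVK // intr_eq0 denq_neq0.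
have: n i = 0.
  apply: (intrel _ n (leqnn _)); transitivity (D%:~R *: \sum_i k i *: (in_tuple gs)`_i); last
      by rewrite k0 scaler0.
  rewrite scaler_sumr; apply: eq_bigr => j _.
  by rewrite scalerA [_ * k j]mulrC -Dn scaler_int mulrzl.
move/eqP; rewrite -(intr_eq0 rat) Dn mulf_eq0 intr_eq0 (negPf D_nz) orbF.
by move/eqP.
Qed.

Definition spans_mod (gs : seq L) a := exists (n : 'I_(size gs) -> int) o,
  A o /\ a = \sum_i (n i)%:~R * gs`_i + l%:R * o.

(** Were the coefficient of a in a relation prime to l, inverting it modulo l would put a in the
    span. *)
Lemma indep_mod_cons gs a : A a -> {in gs, forall g, A g} ->
  indep_mod gs -> ~ spans_mod gs a -> indep_mod (a :: gs).
Proof.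
move=> Aa Ags ind na n [o Ao]; rewrite big_ord_recl /= => Dn.
have n0 : (l %| n ord0)%Z.
  apply: contra_notT na => ndvd.
  have [u [v Duv]] : exists u v : int, u * n ord0 + v * l%:Z = 1.
    have cop : coprimez (n ord0) l.
      by rewrite coprimez_sym /coprimez /gcdz eqz_nat -[_ == _]/(coprime _ _) prime_coprime.
    by have [[u v] <-] := coprimezP _ _ cop; exists u, v.
  have D : u%:~R * (n ord0)%:~R + v%:~R * l%:R = 1 :> L.
    by rewrite -[l%:R]/(l%:Z%:~R) -!intrM -intrD Duv.
  exists (fun i => - u * n (lift ord0 i)), (u%:~R * o + v%:~R * a); split.
    by apply: roiD; apply: roiM => //; apply: roi_int.
  have -> : \sum_i (- u * n (lift ord0 i))%:~R * gs`_i = - u%:~R * \sum_i (n (lift ord0 i))%:~R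
      * gs`_i.
    by rewrite mulr_sumr; apply: eq_bigr => i _; rewrite intrM rmorphN mulrA.
  have -> : \sum_i (n (lift ord0 i))%:~R * gs`_i = l%:R * o - (n ord0)%:~R * a by rewrite -Dn; ring.
  by transitivity ((u%:~R * (n ord0)%:~R + v%:~R * l%:R) * a); [rewrite D mul1r | ring].
have [d Dd] := dvdzP n0.
have ngs : forall i, (l %| n (lift ord0 i))%Z.
  apply: ind; exists (o - d%:~R * a); first by apply: roiB => //; apply: roiM => //; apply: roi_int.
  apply/eqP; rewrite mulrBr -Dn Dd intrM -subr_eq0 -[l%:R]/(l%:Z%:~R); apply/eqP; ring.
by move=> i; case: (unliftP ord0 i) => [j ->|->].
Qed.

(** An independent family in I is enlarged until it spans; the dimension of L stops this process. An
    ideal containing l is thus generated by l and the finite family [gs]. *)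
Lemma fg_mod (I : L -> Prop) : is_ideal A I ->
  exists2 gs : seq L, {in gs, forall g, I g} & forall a, I a -> spans_mod gs a.
Proof.
move=> idI; suff grow k gs : {in gs, forall g, I g} -> indep_mod gs -> (\dim {:L} - size gs <
    k)%N ->
    exists2 gs : seq L, {in gs, forall g, I g} & forall a, I a -> spans_mod gs a.
  by apply: (grow _ [::]) => // n _ [].
elim: k gs => // k IH gs Igs ind ltk.
have [|nspan] := classic (forall a, I a -> spans_mod gs a); first by exists gs.
have [a Ia na] : exists2 a, I a & ~ spans_mod gs a.
  by apply: NNPP => H; apply: nspan => a Ia; apply: NNPP => na; apply: H; exists a.
have inda : indep_mod (a :: gs).
  by apply: indep_mod_cons => // [|g /Igs]; apply: (idl_roi idI).
apply: (IH (a :: gs)) => // [g /[!inE]/predU1P[->|/Igs] //|].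
have := indep_mod_free inda; rewrite /free => /eqP sz.
have := dimvS (subvf <<a :: gs>>); rewrite sz /= => le_sz.
by rewrite -ltnS; apply: leq_trans ltk; rewrite ltnS ltn_sub2l.
Qed.
End FiniteGeneration.

(** * Nakayama's lemma for a prime ideal *)

Section Nakayama.
Variables (L : fieldExtType rat) (E : {subfield L}) (P : L -> Prop).
Local Notation A := (ring_of_integers E).
Hypothesis primeP : is_prime_ideal A P.
Let idP : is_ideal A P. Proof. by case: primeP. Qed.

(** Congruence modulo P within A is compatible with the sums and products of the determinant
    expansion. *)
Lemma det_congr_ideal k (M : 'M[L]_k) : (forall i j, P (M i j - (i == j)%:R)) -> P (\det M - 1).
Proof.
move=> MP; pose R x y := [/\ A x, A y & P (x - y)].
have Rrefl x : A x -> R x x by move=> Ax; split=> //; rewrite subrr; apply: idl_zero idP.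
have RD x1 x2 y1 y2 : R x1 x2 -> R y1 y2 -> R (x1 + y1) (x2 + y2).
  move=> [? ? ?] [? ? ?]; split; try exact: roiD.
  by rewrite opprD addrACA; apply: (idl_add idP).
have RM x1 x2 y1 y2 : R x1 x2 -> R y1 y2 -> R (x1 * y1) (x2 * y2).
  move=> [Ax1 Ax2 Px] [Ay1 Ay2 Py]; split; try exact: roiM.
  have -> : x1 * y1 - x2 * y2 = x1 * (y1 - y2) + y2 * (x1 - x2) by ring.
  by apply: (idl_add idP); apply: (idl_mull idP).
rewrite -(det1 L k).
suff [] : R (\det M) (\det (1%:M : 'M[L]_k)) by [].
apply: (big_ind2 R) => [||s _]; [exact: Rrefl (roi0 E)|exact: RD|].
apply: (RM).
  by case: (odd_perm s); apply: Rrefl; [apply: roiN (roi1 E)|apply: roi1].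
apply: (big_ind2 R) => [||i _]; [exact: Rrefl (roi1 E)|exact: RM|].
rewrite mxE; split=> //; last by case: (_ == _); [apply: roi1 | apply: roi0].
rewrite -[M _ _](subrK (i == s i)%:R); apply: roiD; first exact: (idl_roi idP).
by case: (_ == _); [apply: roi1 | apply: roi0].
Qed.

(* Nakayama's lemma, by the determinant trick on the generators of P. *)
Lemma prime_ideal_not_square x : x != 0 -> P x -> ~ pred_sub P (ideal_exp A P 2).
Proof.
move=> x_nz Px; have [l pr_l Pl] := prime_ideal_prime primeP x_nz Px.
have [gs Pgs span] := fg_mod pr_l idP => PP2.
(* Adding l absorbs the remainder l o of [spans_mod] and provides a nonzero generator. *)
pose hs := l%:R :: gs.
have Phs (i : 'I_(size hs)) : P hs`_i.
  by have: hs`_i \in hs by [exact: mem_nth]; rewrite inE => /predU1P[->|/Pgs].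
have spanA a : P a -> exists o : 'I_(size hs) -> L, (forall i, A (o i)) /\ a = \sum_i o i * hs`_i.
  move=> /span[n [o [Ao Da]]].
  exists (fun i => oapp (fun j => (n j)%:~R) o (unlift ord0 i)); split=> [i|].
    by case: unliftP => [j _|_] //=; apply: roi_int.
  rewrite big_ord_recl unlift_none /= Da addrC mulrC; congr (_ + _).
  by apply: eq_bigr => j _; rewrite liftK.
(* As P is assumed to lie in P^2, the coefficients can be taken in P. *)
have spanP a : P a -> exists o : 'I_(size hs) -> L, (forall i, P (o i)) /\ a = \sum_i o i * hs`_i.
  move=> /PP2[s sP ->].
  elim: s sP => [|u s IH] sP.
    by exists (fun=> 0); split=> [_|]; [apply: idl_zero idP | rewrite big_nil big1 // => i _;
        rewrite mul0r].
  have [v vs|o [Po Do]] := IH; first by apply: sP; rewrite inE vs orbT.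
  have [Pu1 Pu2] := sP u (mem_head _ _).
  have {}Pu2 : P u.2 by apply: (ideal_mul_subl idP) Pu2.
  have [o' [Ao' Do']] := spanA _ Pu2.
  exists (fun i => u.1 * o' i + o i); split=> [i|].
    apply: (idl_add idP) => //. by apply: (idl_mulr idP).
  rewrite big_cons Do Do' mulr_sumr -big_split; apply: eq_bigr => i _ /=; ring.
have [M HM] := fin_all_exists (fun i => spanP _ (Phs i)).
pose N : 'M[L]_(size hs) := \matrix_(i, j) ((i == j)%:R - M i j).
have PN : P (\det N - 1).
  apply: det_congr_ideal => i j; rewrite mxE addrC addKr; apply: (idl_opp idP).
  by case: (HM i).
pose v : 'cV[L]_(size hs) := \col_i hs`_i.
have Nv : N *m v = 0.
  apply/colP=> i; rewrite !mxE; have [_ Di] := HM i.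
  rewrite (eq_bigr (fun j => (i == j)%:R * hs`_j - M i j * hs`_j)); last first.
    by move=> j _; rewrite !mxE mulrBl.
  rewrite big_split sumrN /= -Di (bigD1 i) //= eqxx mul1r big1 ?addr0 ?subrr //.
  by move=> j /negPf; rewrite eq_sym => ->; rewrite mul0r.
have detN : \det N = 0.
  have: \det N *: v = 0 by rewrite -mul_scalar_mx -mul_adj_mx -mulmxA Nv mulmx0.
  (* Entry 0 of v is l, which is nonzero in L. *)
  move/colP/(_ ord0); rewrite !mxE /= => /eqP.
  by rewrite mulf_eq0 natL_eq0 -leqn0 leqNgt prime_gt0 // orbF => /eqP.
case: primeP => _ P1 _; apply: P1; rewrite -[1]opprK; apply: (idl_opp idP).
by rewrite -[- 1]add0r -detN.
Qed.
End Nakayama.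

(** * Trivial inertia implies ramification index 1 *)

Section Unramified.
Variables (L : splittingFieldType rat) (K E : {subfield L}).
Local Notation A := (ring_of_integers E).

Lemma roi_gal (g : gal_of E) x : A x -> A (g x).
Proof.
move=> [Ex [p mon rp]]; split; first exact: memv_gal.
exists p => //; rewrite -(fmorph_root g) in rp.
rewrite -map_poly_comp in rp; rewrite (eq_map_poly (g := g \o intr)) // => a.
by rewrite /= rmorph_int.
Qed.

(* The functions induced on the Galois group by the elements of
   O_E (x) O_E, the tensor x (x) y giving g |-> x * g y. *)
Definition galois_form (phi : gal_of E -> L) := exists2 s : seq (L * L),
  forall u, u \in s -> A u.1 /\ A u.2
  & forall g, g \in 'Gal(E / K)%g -> phi g = \sum_(u <- s) u.1 * g u.2.

Lemma galois_form1 : galois_form (fun=> 1).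
Proof.
exists [:: (1, 1)] => [u /[!inE]/eqP->|g _]; first by split; apply: roi1.
by rewrite big_seq1 /= rmorph1 mul1r.
Qed.

Lemma galois_formB w c : A w -> A c -> galois_form (fun g => g w - c).
Proof.
move=> Aw Ac; exists [:: (1, w); (- c, 1)] => [u|g _].
  by rewrite !inE => /orP[]/eqP->; split=> //=; first [exact: roi1 | exact: roiN].
by rewrite big_cons big_seq1 /= rmorph1; ring.
Qed.

Lemma galois_formM phi psi :
  galois_form phi -> galois_form psi -> galois_form (fun g => phi g * psi g).
Proof.
move=> [s sA Dphi] [s' sA' Dpsi].
exists [seq (u.1 * v.1, u.2 * v.2) | u <- s, v <- s'] => [_ /allpairsP[[u v] /= [/sA[? ?]
    /sA'[? ?] ->]]|g Gg].
  by split; apply: roiM.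
rewrite Dphi // Dpsi // big_allpairs_dep mulr_suml; apply: eq_bigr => u _.
by rewrite mulr_sumr; apply: eq_bigr => v _ /=; rewrite rmorphM; ring.
Qed.

(** In the sum of g z phi(g) over the group only g = 1 contributes; expanding phi and exchanging the
    sums gives the traces. *)
Lemma galois_form_trace phi z : galois K E -> A z -> galois_form phi ->
    (forall g, g \in 'Gal(E / K)%g -> g != 1%g -> phi g = 0) ->
  exists2 s : seq (L * L), forall u, u \in s -> A u.1 /\ A u.2
    & z * phi 1%g = \sum_(u <- s) u.1 * galTrace K E (u.2 * z).
Proof.
move=> galE Az [s sA Dphi] phi0; exists s => //.
transitivity (\sum_(g in 'Gal(E / K)%g) g z * phi g).
  rewrite (bigD1 1%g) //= gal_id big1 ?addr0 // => g /andP[Gg g1].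
  by rewrite phi0 ?mulr0.
transitivity (\sum_(g in 'Gal(E / K)%g) \sum_(u <- s) u.1 * g (u.2 * z)).
  apply: eq_bigr => g Gg; rewrite Dphi // mulr_sumr; apply: eq_bigr => u _.
  by rewrite rmorphM; ring.
by rewrite exchange_big; apply: eq_bigr => u _; rewrite mulr_sumr.
Qed.

Section Prime.
Variable P : L -> Prop.
Hypothesis primeP : is_prime_ideal A P.
Let idP : is_ideal A P. Proof. by case: primeP. Qed.

Let primeM a b : A a -> A b -> P (a * b) -> P a \/ P b.
Proof. by case: primeP => _ _; apply. Qed.

(** phi is the product over g <> 1 of the forms h |-> h w - g w, with w moved by g modulo P: each
    vanishes at h = g and is w - g w, outside P, at h = 1. *)
Lemma galois_form_separating : galois K E ->
    (forall g, g \in 'Gal(E / K)%g -> g != 1%g -> exists2 w, A w & ~ P (g w - w)) ->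
  exists phi, [/\ galois_form phi, ~ P (phi 1%g)
    & forall g, g \in 'Gal(E / K)%g -> g != 1%g -> phi g = 0].
Proof.
move=> galE inert; have [_ P1 _] := primeP.
suff [phi [fphi Pphi phi0]] : exists phi, [/\ galois_form phi, ~ P (phi 1%g)
    & forall g, g \in enum 'Gal(E / K)%g -> g != 1%g -> phi g = 0].
  by exists phi; split=> // g Gg; apply: phi0; rewrite mem_enum.
have: {subset enum 'Gal(E / K)%g <= 'Gal(E / K)%g} by move=> g; rewrite mem_enum.
elim: (enum _) => [|g s IH] sG; first by exists (fun=> 1); split=> //; exact: galois_form1.
have [|phi [fphi Pphi phi0]] := IH; first by move=> h hs; apply: sG; rewrite inE hs orbT.
have [g1|g_neq1] := eqVneq g 1%g.
  by exists phi; split=> // h /[!inE]/predU1P[->|/phi0//]; rewrite g1 eqxx.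
have [w Aw Pw] := inert g (sG _ (mem_head _ _)) g_neq1.
exists (fun h => phi h * (h w - g w)); split.
- by apply: galois_formM => //; apply: galois_formB => //; apply: roi_gal.
- have [u uA Du] := fphi; rewrite gal_id => Pprod; case: (primeM _ _ Pprod) => //.
  + rewrite Du ?group1 //; apply: (idl_sum (roi_ideal E)) => v /uA[? ?].
    by apply: roiM => //; apply: roi_gal.
  + by apply: roiB => //; apply: roi_gal.
  by move=> Pgw; apply: Pw; rewrite -opprB; apply: (idl_opp idP).
move=> h; rewrite inE => /predU1P[->|hs h1]; first by rewrite subrr mulr0.
by rewrite phi0 ?mul0r.
Qed.

(* u avoids P but lies in each conjugate of P that is distinct from P; no prime
   decomposition of the ideal generated by P :&: K is needed. *)
Lemma gal_stable_multiplier : exists u, [/\ A u, ~ P u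
  & forall a g, P a -> g \in 'Gal(E / K)%g -> P (g (a * u))].
Proof.
have [_ P1 _] := primeP.
suff [u [Au Pu Hu]] : exists u, [/\ A u, ~ P u
  & forall a g, P a -> g \in enum 'Gal(E / K)%g -> P (g (a * u))].
  by exists u; split=> // a g Pa Gg; apply: Hu; rewrite ?mem_enum.
elim: (enum _) => [|g s [u [Au Pu Hu]]].
  by exists 1; split=> //; apply: roi1.
(* If some v outside P has g v in P, multiplying u by v settles g. Otherwise g^-1 P is contained in
   P, and so is g P because g has finite order. *)
have [[v [Av Pv Pgv]]|nv] := classic (exists v, [/\ A v, ~ P v & P (g v)]).
  exists (u * v); split=> [||a h Pa]; first exact: roiM.
    by move/(primeM Au Av) => [].
  rewrite mulrA inE => /predU1P[->|hs]; rewrite rmorphM.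
    apply: (idl_mull idP) => //; apply: roi_gal; apply: roiM => //.
    exact: (idl_roi idP).
  by apply: (idl_mulr idP); [apply: roi_gal | apply: Hu].
exists u; split=> // a h Pa; rewrite inE => /predU1P[->|]; last exact: Hu.
have gP v : A v -> P (g v) -> P v.
  by move=> Av Pgv; apply: NNPP => Pv; apply: nv; exists v.
have gkP (k : nat) v : A v -> P ((g ^+ k)%g v) -> P v.
  elim: k v => [|k IH] v Av; first by rewrite gal_id.
  by rewrite expgS galM ?(proj1 Av) // => /(IH _ (roi_gal _ Av)); apply: gP.
have Aau : A (a * u) by apply: roiM => //; apply: (idl_roi idP).
apply: (gkP #[g]%g.-1); first exact: roi_gal.
rewrite -galM ?(proj1 Aau) // -expgS prednK ?order_gt0 // expg_order gal_id.
exact: (idl_mulr idP).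
Qed.

Lemma unramified_at x : galois K E -> x != 0 -> P x ->
    (forall g, g \in 'Gal(E / K)%g -> g != 1%g -> exists2 w, A w & ~ P (g w - w)) ->
  is_ramification_index K E P 1.
Proof.
move=> galE x_nz Px inert; have [l pr_l Pl] := prime_ideal_prime primeP x_nz Px.
have PA : pred_sub P A by move=> ?; apply: (idl_roi idP).
split=> [_ [s sP ->]|sub2].
  by exists s => // u /sP[[? _] ?].
apply: (prime_ideal_not_square primeP x_nz Px) => a Pa.
have idQ : is_ideal A (ideal_exp A P 2).
  by do !apply: ideal_mul_ideal => //; apply: roi_ideal.
(* P^2 unfolds to P (P A), hence the trailing factor 1. *)
have QPP b c : P b -> P c -> ideal_exp A P 2 (b * c).
  move=> Pb Pc; apply: mem_ideal_mul => //; rewrite -[c]mulr1.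
  by apply: mem_ideal_mul => //; apply: roi1.
(* c has an inverse d modulo P, and b (1 - c d) is in P^2. *)
have Qcancel b c : P b -> A c -> ~ P c -> ideal_exp A P 2 (b * c) -> ideal_exp A P 2 b.
  move=> Pb Ac Pc Qbc; have [d Ad Pd] := prime_ideal_maximal primeP pr_l Pl Ac Pc.
  have -> : b = b * c * d + b * (1 - c * d) by ring.
  by apply: (idl_add idQ); [apply: (idl_mulr idQ) | apply: QPP].
have [u [Au Pu Hu]] := gal_stable_multiplier.
have [phi [fphi Pphi phi0]] := galois_form_separating galE inert.
apply: (Qcancel a u) => //.
have Pau : P (a * u) by apply: (idl_mulr idP).
have [s sA Ds] := galois_form_trace galE (PA _ Pau) fphi phi0.
have Aphi : A (phi 1%g).
  case: fphi => s' sA' ->; rewrite ?group1 //.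
  apply: (idl_sum (roi_ideal E)) => v /sA'[? ?].
  by apply: roiM => //; apply: roi_gal.
apply: (Qcancel _ (phi 1%g)) => //; apply: sub2; rewrite Ds.
(* All conjugates of a u are in P, so these traces lie in both P and K. *)
exists [seq (galTrace K E (v.2 * (a * u)), v.1) | v <- s].
  move=> _ /mapP[v /sA[Av1 Av2] ->]; split=> //=; split; last first.
    by rewrite mem_galTrace // rpredM ?(proj1 Av2) ?(proj1 (PA _ Pau)).
  rewrite /galTrace -big_enum; apply: (idl_sum idP) => g; rewrite mem_enum => Gg.
  by rewrite rmorphM; apply: (idl_mull idP); [apply: roi_gal | apply: Hu].
by rewrite big_map; apply: eq_bigr => v _ /=; rewrite mulrC.
Qed.
End Prime.
End Unramified.

(** * Inertia on the roots of the septic *)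

(** The logarithmic derivative, used for the trace of 7 d / (th - a). *)
Lemma horner_deriv_prod_XsubC (F : fieldType) (rs : seq F) a : a \notin rs ->
  (\prod_(r <- rs) ('X - r%:P))^`().[a]
    = (\prod_(r <- rs) ('X - r%:P)).[a] * \sum_(r <- rs) (a - r)^-1.
Proof.
elim: rs => [|r rs IH]; first by rewrite !big_nil derivC horner0 mulr0.
rewrite inE negb_or => /andP[ar /IH{}IH]; rewrite !big_cons derivM derivXsubC mul1r.
rewrite hornerD !hornerM hornerXsubC IH; field.
by rewrite subr_eq0.
Qed.

(* From here on g is assumed to be in the inertia group of P, with a view to a
   contradiction. *)
Section SepticInertia.
Variables (t : int) (L : splittingFieldType rat) (K E : {subfield L}) (g : gal_of E).
Local Notation A := (ring_of_integers E).
Variables (th : L) (P : L -> Prop).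
Hypotheses (Eth : th \in E) (primeP : is_prime_ideal A P).
Hypothesis Dp : map_poly (in_alg L) (septic t) = \prod_(k < 7) ('X - ((g ^+ k)%g th)%:P).
Hypothesis inert : forall w, A w -> P (g w - w).
Let idP : is_ideal A P. Proof. by case: primeP. Qed.
Let T : L := t%:~R.
Let ths := [seq (g ^+ k)%g th | k <- iota 0 7].

Let Dths : map_poly (in_alg L) (septic t) = \prod_(x <- ths) ('X - x%:P).
Proof. by rewrite Dp big_map -[iota 0 7]/(index_iota 0 7) big_mkord. Qed.

Lemma septic_root_integral x : root (map_poly (in_alg L) (septic t)) x -> integralOver (intr :
    int -> L) x.
Proof.
move=> /rootP; rewrite horner_septic => rx.
exists (Poly [:: t ^+ 2 - 11 * t + 33; - 28; 14 * t; - 7 * (t - 3); - 14; 0; 0; 1]).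
  by rewrite monicE lead_coefE (@PolyK _ 0).
rewrite map_Poly_id0 // rootE horner_Poly /=; apply/eqP; rewrite -[RHS]rx.
by ring.
Qed.

Lemma inert_pow k w : A w -> P ((g ^+ k)%g w - w).
Proof.
move=> Aw; elim: k => [|k IH]; first by rewrite gal_id subrr; apply: (idl_zero idP).
rewrite expgSr galM ?(proj1 Aw) //.
rewrite -[_ - w](subrKA ((g ^+ k)%g w)); apply: (idl_add idP) => //.
by apply: inert; apply: roi_gal.
Qed.

Lemma prod_congr_exp s z : A z -> (forall x, x \in s -> P x) ->
  P ((\prod_(x <- s) ('X - x%:P)).[z] - z ^+ size s).
Proof.
move=> Az; elim: s => [|x s IH] sP; first by rewrite big_nil hornerC subrr; apply: (idl_zero idP).
have {}IH : P ((\prod_(x <- s) ('X - x%:P)).[z] - z ^+ size s).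
  by apply: IH => u us; apply: sP; rewrite inE us orbT.
rewrite big_cons hornerM hornerXsubC /= exprS; set Q := _.[z] in IH *.
have -> : (z - x) * Q - z * z ^+ size s = (z - x) * (Q - z ^+ size s) - z ^+ size s * x by ring.
have Px := sP x (mem_head _ _).
have AzX n : A (z ^+ n) by elim: n => [|n IHn]; rewrite ?exprS; [apply: roi1 | apply: roiM].
apply: (idl_sub idP); apply: (idl_mull idP) => //.
by apply: roiB => //; apply: (idl_roi idP).
Qed.

Lemma inert_not_away (l : nat) : prime l -> l != 7%N -> P l%:R -> False.
Proof.
move=> pr_l l7 Pl.
have rth : root (map_poly (in_alg L) (septic t)) th.
  by rewrite Dths root_prod_XsubC; apply/mapP; exists 0; rewrite ?gal_id.
have Ath : A th by split=> //; apply: septic_root_integral.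
have [_ P1 PM] := primeP.
have int_unit (n : int) : coprimez n l -> forall x, A x -> P (n%:~R * x) -> P x.
  move=> /coprimezP[[u v] /= Duv] x Ax Pnx.
  have -> : x = u%:~R * (n%:~R * x) + v%:~R * x * l%:R.
    transitivity ((u * n + v * l%:Z)%:~R * x); first by rewrite Duv mul1r.
    by rewrite intrD !intrM; ring.
  apply: (idl_add idP); first by apply: (idl_mull idP) => //; apply: roi_int.
  by apply: (idl_mull idP) => //; apply: roiM => //; apply: roi_int.
have cop7 : coprimez 7 l.
  rewrite /coprimez /gcdz eqz_nat -[_ == _]/(coprime _ _) prime_coprime // dvdn_prime2 // eq_sym.
  exact: l7.
(* The conjugates of th sum to 0 and are congruent to th, so 7 th is in P, and 7 is invertible
   modulo P. *)
have Pth : P th.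
  apply: (int_unit 7) => //; have sum0 : \sum_(x <- ths) x = 0.
    have := @coefPn_prod_XsubC _ ths isT.
    rewrite -Dths size_map size_iota coef_map /= /septic !(coefB, coefD, coefZ, coefXn, coefX,
        coefC) /=.
    by rewrite !(mulr0, subr0, addr0) scale0r => /eqP; rewrite eq_sym oppr_eq0 => /eqP.
  have: P (\sum_(k <- iota 0 7) ((g ^+ k)%g th - th)) by apply: (idl_sum idP) => k _; apply:
      inert_pow.
  move/(idl_opp idP); set S := - _; suff -> : 7%:~R * th = S by [].
  by rewrite -[LHS]subr0 -sum0 /S /ths big_map /= !big_cons !big_nil; ring.
have Pths x : x \in ths -> P x.
  move=> /mapP[k _ ->]; rewrite -[(g ^+ k)%g th](subrK th).
  by apply: (idl_add idP) => //; apply: inert_pow.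
(* f, the septic minus X^7, takes values in P at the integers. Below, f(0) - f(2) = 7 * 2^4, f(1) -
   f(0) = 7 (T - 3) and f(0) - (T - 3) (T - 8) - 8 = 1. *)
have ev (z : int) : P ((z%:~R ^+ 7 - 14 * z%:~R ^+ 4 - 7 * (T - 3) * z%:~R ^+ 3
    + 14 * T * z%:~R ^+ 2 - 28 * z%:~R + (T ^+ 2 - 11 * T + 33)) - z%:~R ^+ 7).
  rewrite -(horner_septic (in_alg L)) Dths; apply: prod_congr_exp => //.
  exact: roi_int.
have Peq x x' : P x -> x = x' -> P x' by move=> + <-.
have P16 : P ((2 ^+ 4 : int)%:~R * 1).
  apply: (int_unit 7) => //; first by rewrite mulr1; apply: roi_int.
  by apply: Peq (idl_sub idP (ev 0) (ev 2)) _; rewrite -/T; ring.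
have P2 : P 2.
  have A2 : A 2 by apply: (roi_int _ 2).
  have A4 : A (2 * 2) by apply: roiM.
  have [|//|] := PM _ _ A4 A4 _; last by case/(PM _ _ A2 A2).
    by apply: Peq P16 _; ring.
  by case/(PM _ _ A2 A2).
have PT : P (T - 3).
  apply: (int_unit 7) => //; first by apply: roiB; [apply: roi_int | apply: (roi_int _ 3)].
  by apply: Peq (idl_sub idP (ev 1) (ev 0)) _; ring.
apply: P1.
have PT8 : P ((T - 3) * (T - 8)).
  by apply: (idl_mulr idP) => //; apply: roiB; [apply: roi_int | apply: (roi_int _ 8)].
have P8 : P (4 * 2) by apply: (idl_mull idP) => //; apply: (roi_int _ 4).
by apply: Peq (idl_sub idP (idl_sub idP (ev 0) PT8) P8) _; ring.
Qed.

(* The septic at a + z is z^7 + c6 z^6 + .. + c1 z + N d, with 7 c1 = N u and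
   7^k ck = N ek, so that w = 7 d / (th - a) is a root of
   W^7 + u W^6 + e2 d W^5 + .. + e7 d^6. It is thus integral of trace - u, whereas
   inertia makes this trace congruent to 7 w. *)
Lemma inert_not_at7 (a N d u e2 e3 e4 e5 e6 e7 : int) : N != 0 -> d != 0 -> ~~ (7 %| u)%Z ->
    a ^+ 7 - 14 * a ^+ 4 - 7 * (t - 3) * a ^+ 3 + 14 * t * a ^+ 2 - 28 * a
      + (t ^+ 2 - 11 * t + 33) = N * d ->
    7 * (7 * a ^+ 6 - 56 * a ^+ 3 - 21 * (t - 3) * a ^+ 2 + 28 * t * a - 28) = N * u ->
    7 ^+ 2 * (21 * a ^+ 5 - 84 * a ^+ 2 - 21 * (t - 3) * a + 14 * t) = N * e2 ->
    7 ^+ 3 * (35 * a ^+ 4 - 56 * a - 7 * (t - 3)) = N * e3 ->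
    7 ^+ 4 * (35 * a ^+ 3 - 14) = N * e4 ->
    7 ^+ 5 * (21 * a ^+ 2) = N * e5 -> 7 ^+ 6 * (7 * a) = N * e6 -> 7 ^+ 7 = N * e7 ->
  ~ P 7.
Proof.
move=> N_nz d_nz u7 Hd Hu H2 H3 H4 H5 H6 H7 P7.
have intL_eq0 (n : int) : (n%:~R == 0 :> L) = (n == 0).
  by rewrite -(rmorph_int (in_alg L)) fmorph_eq0 intr_eq0.
have rootE x : x \in ths -> x ^+ 7 - 14 * x ^+ 4 - 7 * (T - 3) * x ^+ 3
    + 14 * T * x ^+ 2 - 28 * x + (T ^+ 2 - 11 * T + 33) = 0.
  by rewrite -root_prod_XsubC -Dths => /rootP; rewrite horner_septic.
pose al : L := a%:~R.
have HuL : 7 * (7 * al ^+ 6 - 56 * al ^+ 3 - 21 * (T - 3) * al ^+ 2 + 28 * T * al - 28) = N%:~R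
    * u%:~R.
  by rewrite -intrM -Hu /al /T; ring.
have H2L : 7 ^+ 2 * (21 * al ^+ 5 - 84 * al ^+ 2 - 21 * (T - 3) * al + 14 * T) = N%:~R * e2%:~R.
  by rewrite -intrM -H2 /al /T; ring.
have H3L : 7 ^+ 3 * (35 * al ^+ 4 - 56 * al - 7 * (T - 3)) = N%:~R * e3%:~R.
  by rewrite -intrM -H3 /al /T; ring.
have H4L : 7 ^+ 4 * (35 * al ^+ 3 - 14) = N%:~R * e4%:~R by rewrite -intrM -H4 /al; ring.
have H5L : 7 ^+ 5 * (21 * al ^+ 2) = N%:~R * e5%:~R by rewrite -intrM -H5 /al; ring.
have H6L : 7 ^+ 6 * (7 * al) = N%:~R * e6%:~R by rewrite -intrM -H6 /al; ring.
have H7L : 7 ^+ 7 = N%:~R * e7%:~R :> L by rewrite -intrM -H7; ring.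
have nrootE : (map_poly (in_alg L) (septic t)).[al] = N%:~R * d%:~R.
  by rewrite horner_septic -intrM -Hd /al; ring.
have root_nz x : x \in ths -> x - al != 0.
  move=> xs; rewrite subr_eq0; apply: contraTneq isT => Ex.
  move: nrootE; rewrite horner_septic -Ex rootE // => /eqP.
  by rewrite eq_sym mulf_eq0 !intL_eq0 (negPf N_nz) (negPf d_nz).
have th_in : th \in ths by apply/mapP; exists 0; rewrite ?gal_id.
pose z := th - al; pose w := 7 * d%:~R / z.
have z_nz : z != 0 by apply: root_nz.
have Aw : A w.
  split; first by rewrite rpred_div // ?rpredM ?rpred_int ?rpred_nat // rpredB ?rpred_int.
  exists (Poly [:: e7 * d ^+ 6; e6 * d ^+ 5; e5 * d ^+ 4; e4 * d ^+ 3; e3 * d ^+ 2; e2 * d; u; 1]).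
    by rewrite monicE lead_coefE (@PolyK _ 0).
  rewrite map_Poly_id0 // /root horner_Poly /=.
  (* Multiplied by N z^7, the value at w becomes 7^7 d^6 times the septic at th. *)
  have Nz_nz : N%:~R * z ^+ 7 != 0 by rewrite mulf_neq0 ?expf_neq0 ?intL_eq0.
  rewrite -(mulrI_eq0 _ (mulfI Nz_nz)) !(intrM, rmorphXn) /=.
  apply/eqP; transitivity (d%:~R ^+ 6 * (7 ^+ 7 * (N%:~R * d%:~R) + 7 ^+ 6 * (N%:~R * u%:~R) * z
     + 7 ^+ 5 * (N%:~R * e2%:~R) * z ^+ 2 + 7 ^+ 4 * (N%:~R * e3%:~R) * z ^+ 3
     + 7 ^+ 3 * (N%:~R * e4%:~R) * z ^+ 4 + 7 ^+ 2 * (N%:~R * e5%:~R) * z ^+ 5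
     + 7 * (N%:~R * e6%:~R) * z ^+ 6 + (N%:~R * e7%:~R) * z ^+ 7)).
    by rewrite /w; field.
  rewrite -nrootE horner_septic -/T -HuL -H2L -H3L -H4L -H5L -H6L -H7L.
  by rewrite -[RHS](mulr0 (7 ^+ 7 * d%:~R ^+ 6)) -(rootE th) // /z; ring.
(* By the logarithmic derivative at a, where the septic p takes the value N d, the conjugates of w
   sum to - 7 p'(a) / N = - u. *)
have trw : \sum_(k <- iota 0 7) (g ^+ k)%g w = - u%:~R.
  have al_ths : al \notin ths by apply/negP=> /root_nz; rewrite subrr eqxx.
  have := horner_deriv_prod_XsubC al_ths; rewrite -Dths nrootE horner_deriv_septic -/T => D1.
  move: HuL; rewrite D1 mulrCA -mulrA => /(mulfI (_ : N%:~R != 0)).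
  rewrite intL_eq0 => /(_ N_nz) <-; rewrite mulrA big_map mulr_sumr -sumrN.
  apply: eq_bigr => k _; rewrite /w /z fmorph_div rmorphM rmorphB !rmorph_int rmorph_nat.
  by rewrite -[_ - a%:~R]opprB invrN mulrN [7 * _]mulrC.
have Pu : P u%:~R.
  have: P (\sum_(k <- iota 0 7) ((g ^+ k)%g w - w)) by apply: (idl_sum idP) => k _; apply:
      inert_pow.
  move=> PS; have Pw7 : P (w * 7) by apply: (idl_mull idP).
  have := idl_opp idP (idl_add idP PS Pw7).
  suff -> : - (\sum_(k <- iota 0 7) ((g ^+ k)%g w - w) + w * 7) = u%:~R by [].
  by rewrite -[RHS]opprK -trw /= !big_cons !big_nil; ring.
case: primeP => _ P1 _; apply: P1.
have cop : coprimez u 7.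
  by rewrite coprimez_sym /coprimez /gcdz eqz_nat -[_ == _]/(coprime _ _) prime_coprime.
have [[v v'] /= Duv] := coprimezP _ _ cop.
have -> : 1 = v%:~R * u%:~R + v'%:~R * 7 :> L by rewrite -[LHS]/(1%:~R) -Duv intrD !intrM.
by apply: (idl_add idP); apply: (idl_mull idP) => //; apply: roi_int.
Qed.
End SepticInertia.

(** * The congruences on t at the prime 7 *)

Lemma size_septic t : size (septic t) = 8%N.
Proof.
rewrite /septic -!addrA size_polyDl ?size_polyXn //.
rewrite ltnS; apply/leq_sizeP => j ltj.
rewrite !(coefD, coefN, coefZ, coefXn, coefX, coefC).
by case: j ltj => [|[|[|[|[|[|j]]]]]] //= _; rewrite !(mulr0, oppr0, addr0).
Qed.

(** Supplies d <> 0 in [inert_not_at7]: an irreducible polynomial of degree 7 has no rational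
    root. *)
Lemma septic_int_root (t a : int) : irreducible_poly (septic t) ->
  a ^+ 7 - 14 * a ^+ 4 - 7 * (t - 3) * a ^+ 3 + 14 * t * a ^+ 2 - 28 * a
      + (t ^+ 2 - 11 * t + 33) != 0.
Proof.
move=> [_ irr]; apply/eqP=> pa0.
have: ('X - a%:~R%:P) %| septic t.
  have <- : map_poly idfun (septic t) = septic t by apply: map_poly_id.
  by rewrite dvdp_XsubCl /root horner_septic -[X in _ == X](mulr0z 1) -pa0; apply/eqP; ring.
move/irr; rewrite size_XsubC => /(_ isT) /eqp_size.
by rewrite size_XsubC size_septic.
Qed.

Lemma eq_modzP (t c m : int) : (t = c %[mod m])%Z -> exists q, t = c + m * q.
Proof.
move/eqP; rewrite eqz_mod_dvd => /dvdzP[q Dq]; exists q.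
by rewrite mulrC -Dq; ring.
Qed.

Lemma ndvdz7 (u r v : int) : u = r + 7 * v -> ~~ (7 %| r)%Z -> ~~ (7 %| u)%Z.
Proof. by move=> ->; rewrite rpredDr //; apply: dvdz_mulr. Qed.

Section At7.
Variables (t : int) (L : splittingFieldType rat) (K E : {subfield L}) (g : gal_of E).
Local Notation A := (ring_of_integers E).
Variables (th : L) (P : L -> Prop).
Hypotheses (Eth : th \in E) (primeP : is_prime_ideal A P).
Hypothesis Dp : map_poly (in_alg L) (septic t) = \prod_(k < 7) ('X - ((g ^+ k)%g th)%:P).
Hypothesis inert : forall w, A w -> P (g w - w).
Hypothesis irr7 : irreducible_poly (septic t).

(** The case N = 49: u is a seventh of the derivative at a, and e2, .., e7 exist because 49 divides
    7^k for k >= 2. *)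
Lemma inert_not_at7_mod49 (a d v r : int) : ~~ (7 %| r)%Z ->
    a ^+ 7 - 14 * a ^+ 4 - 7 * (t - 3) * a ^+ 3 + 14 * t * a ^+ 2 - 28 * a
      + (t ^+ 2 - 11 * t + 33) = 49 * d ->
    a ^+ 6 - 8 * a ^+ 3 - 3 * (t - 3) * a ^+ 2 + 4 * t * a - 4 = r + 7 * v ->
  ~ P 7.
Proof.
move=> r7 Dd Du; have d_nz : d != 0.
  by apply: contraNneq (septic_int_root a irr7) => d0; rewrite Dd d0 mulr0.
apply: (inert_not_at7 (u := r + 7 * v) (e2 := 21 * a ^+ 5 - 84 * a ^+ 2 - 21 * (t - 3) * a + 14 * t)
   (e3 := 7 * (35 * a ^+ 4 - 56 * a - 7 * (t - 3))) (e4 := 49 * (35 * a ^+ 3 - 14))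
   (e5 := 343 * (21 * a ^+ 2)) (e6 := 2401 * (7 * a)) (e7 := 7 ^+ 5) Eth primeP Dp inert _ d_nz
       _ Dd).
- by [].
- exact: ndvdz7 r7.
- rewrite -Du; ring.
- ring.
- ring.
- ring.
- ring.
- ring.
- ring.
Qed.

(** For most classes c, a is an integer at which 49 divides the septic but not its derivative; d and
    v are then polynomials in q, where t = c + 49 q. The classes of - 5 and 743 use N = 2401. *)
Lemma inert_not_at7_admissible : admissible t -> ~ P 7.
Proof.
case=> [[]|[]|] /eq_modzP[q Dt].
- apply: (@inert_not_at7_mod49 4 (369 - 267 * q + 49 * q ^+ 2) (605 - 224 * q) 1) => //;
    rewrite Dt; ring.
- apply: (@inert_not_at7_mod49 5 (1590 - 558 * q + 49 * q ^+ 2) (2207 - 385 * q) 2) => //;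
    rewrite Dt; ring.
(* At a = - 1 the derivative is 343 (1 - 7 q), so N = 49 would make u divisible by 7, whereas N =
   2401 gives u = 1 - 7 q. *)
- have Dd : (-1) ^+ 7 - 14 * (-1) ^+ 4 - 7 * (t - 3) * (-1) ^+ 3 + 14 * t * (-1) ^+ 2 - 28 * (-1)
      + (t ^+ 2 - 11 * t + 33) = 2401 * q ^+ 2 by rewrite Dt; ring.
  apply: (inert_not_at7 (u := 1 + 7 * (- q)) (e2 := -7 + 35 * q)
    (e3 := 5 + 8 - (t - 3)) (e4 := 35 * (-1) - 14) (e5 := 7 * 21) (e6 := - 343) (e7 := 343)
    Eth primeP Dp inert _ _ _ Dd).
  + by [].
  + by apply: contraNneq (septic_int_root (-1) irr7) => d0; rewrite Dd d0 mulr0.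
  + exact: (@ndvdz7 _ 1 (- q)).
  + rewrite ?Dt; ring.
  + rewrite ?Dt; ring.
  + rewrite ?Dt; ring.
  + rewrite ?Dt; ring.
  + rewrite ?Dt; ring.
  + rewrite ?Dt; ring.
  + rewrite ?Dt; ring.
- apply: (@inert_not_at7_mod49 2 (1 - 11 * q + 49 * q ^+ 2) (4 - 28 * q) 4) => //; rewrite Dt; ring.
- apply: (@inert_not_at7_mod49 4 (259 - 223 * q + 49 * q ^+ 2) (504 - 224 * q) 4) => //;
    rewrite Dt; ring.
- apply: (@inert_not_at7_mod49 2 (1 + 11 * q + 49 * q ^+ 2) (-2 - 28 * q) 2) => //; rewrite Dt;
    ring.
(* Again the derivative at a = 5 is 343 u with u prime to 7, while 2401 divides the value. *)
have Dd : 5 ^+ 7 - 14 * 5 ^+ 4 - 7 * (t - 3) * 5 ^+ 3 + 14 * t * 5 ^+ 2 - 28 * 5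
    + (t ^+ 2 - 11 * t + 33) = 2401 * (94 + 950 * q + 2401 * q ^+ 2) by rewrite Dt; ring.
apply: (inert_not_at7 (u := 1 + 7 * (- 76 - 385 * q)) (e2 := - 77 - 4459 * q)
  (e3 := 5 * 625 - 40 - (t - 3)) (e4 := 35 * 125 - 14) (e5 := 7 * (21 * 25)) (e6 := 49 * 35)
      (e7 := 343)
  Eth primeP Dp inert _ _ _ Dd).
- by [].
- by apply: contraNneq (septic_int_root 5 irr7) => d0; rewrite Dd d0 mulr0.
- exact: (@ndvdz7 _ 1 (- 76 - 385 * q)).
- rewrite ?Dt; ring.
- rewrite ?Dt; ring.
- rewrite ?Dt; ring.
- rewrite ?Dt; ring.
- rewrite ?Dt; ring.
- rewrite ?Dt; ring.
- rewrite ?Dt; ring.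
Qed.
End At7.

(** * Unramified places and conclusion *)

Lemma septic_unramified_finite (t : int) (L : splittingFieldType rat) (y s : L) (K E :
    {subfield L}) :
    admissible t -> irreducible_poly (cubic t) -> irreducible_poly (septic t) ->
    root (map_poly (in_alg L) (cubic t)) y -> s ^+ 2 = - 7 -> y \in K -> s \in K ->
    splittingFieldFor K (map_poly (in_alg L) (septic t)) E ->
  unramified_finite K E.
Proof.
move=> ht irr3 irr7 ry s2 Ky Ks splitE P primeP [x Px x_nz].
have [_ cycE] := septic_cyclic irr3 ry s2 Ky Ks splitE.
have galE := septic_galois irr7 splitE.
apply: (unramified_at primeP galE x_nz Px) => g Gg g1.
(* If no w is moved by g modulo P, then g is in the inertia group of P. *)
apply: NNPP => nw; have inert w : ring_of_integers E w -> P (g w - w).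
  by move=> Aw; apply: NNPP => Pw; apply: nw; exists w.
have [th Eth rth] : exists2 th, th \in E & root (map_poly (in_alg L) (septic t)) th.
  have [[|th rs] Drs DE] := splitE.
    by have := eqp_size Drs; rewrite size_map_poly size_septic big_nil size_poly1.
  exists th; first by rewrite -DE seqv_sub_adjoin ?mem_head.
  by rewrite (eqp_root Drs) root_prod_XsubC mem_head.
have Dp := cycE g Gg g1 th rth.
have [l pr_l Pl] := prime_ideal_prime primeP x_nz Px.
have [l7|l_neq7] := eqVneq l 7%N.
  by apply: (inert_not_at7_admissible Eth primeP Dp inert irr7 ht); rewrite -l7.
exact: (inert_not_away Eth primeP Dp inert pr_l l_neq7 Pl).
Qed.

Theorem theorem15 (t : int) (ht : admissible t)
    (hcubic : irreducible_poly (cubic t))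
    (L : splittingFieldType rat) (y : L)
    (hy : root (map_poly (in_alg L) (cubic t)) y) :
  cyclic_extension 1%AS <<1; y>>%AS
  /\ (irreducible_poly (septic t) ->
      forall (s : L) (hs : s ^+ 2 = - 7) (E : {subfield L}),
        let K : {subfield L} := <<1 & [:: s; y]>>%AS in
        splittingFieldFor K (map_poly (in_alg L) (septic t)) E ->
        cyclic_extension K E /\ unramified_extension K E).
Proof.
split=> [|irr7 s hs E K splitE]; first exact: (cubic_cyclic hcubic hy).
have Ks : s \in K by rewrite seqv_sub_adjoin ?mem_head.
have Ky : y \in K by rewrite seqv_sub_adjoin ?inE ?eqxx ?orbT //.
have galE : galois K E := septic_galois irr7 splitE.
have [cycE _] := septic_cyclic hcubic hy hs Ky Ks splitE.
split; first by rewrite /cyclic_extension galE.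
split; first by case/and3P: galE.
  exact: (septic_unramified_finite ht hcubic irr7 hy hs Ky Ks splitE).
(* No embedding is real on K, since s^2 = - 7 is negative. *)
move=> sigma /(_ s Ks) real_s.
by rewrite realEsqr -rmorphXn hs rmorphN rmorph_nat oppr_ge0 lern0 in real_s.
Qed.
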